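(* Let $F$ be a field of characteristic $2$, let $n\geq 2$ be an integer and let $m\in\{1,\dots,n-1\}$. Let $\varphi$ and $\psi$ be two non-hyperbolic, separably $(n-1)$-linked and totally inseparably $m$-linked $n$-fold quadratic Pfister forms over $F$. Then there exists a field extension $K$ of $F$ such that $\varphi_K$ and $\psi_K$ are totally inseparably $(m+1)$-linked, $\varphi_K$ and $\psi_K$ are not isometric, and neither $\varphi_K$ nor $\psi_K$ is hyperbolic.
   Context: $F$ is a field of characteristic $2$. Quadratic forms are considered up to isometry (equality means isometry); $\varphi_K$ denotes scalar extension of $\varphi$ to $K$. The polar form of a quadratic form $\varphi$ is $B_\varphi(v,w)=\varphi(v+w)-\varphi(v)-\varphi(w)$. A quadratic form is hyperbolic if it is an orthogonal sum of hyperbolic planes (forms isometric to $(x,y)\mapsto xy$). $[1,\beta]$ denotes the two-dimensional quadratic form $(x,y)\mapsto x^2+xy+\beta y^2$. A bilinear $r$-fold Pfister form over $F$ is a symmetric bilinear form isometric to $\langle\!\langle\alpha_1,\dots,\alpha_r\rangle\!\rangle=\langle 1,\alpha_1\rangle\otimes\dots\otimes\langle 1,\alpha_r\rangle$ with $\alpha_i\in F^\times$ (the $0$-fold one is $\langle 1\rangle$), where $\langle a_1,\dots,a_s\rangle$ is the diagonal bilinear form. For a symmetric bilinear form $B$ on $V$ and a quadratic form $\varphi$ on $W$, $B\otimes\varphi$ is the quadratic form on $V\otimes_F W$ determined by $(B\otimes\varphi)(v\otimes w)=B(v,v)\varphi(w)$ (with polar form $B\otimes B_\varphi$). A quadratic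 $n$-fold Pfister form over $F$ is a form $\langle\!\langle\alpha_1,\dots,\alpha_{n-1}\rangle\!\rangle\otimes[1,\beta]$ with $\alpha_i\in F^\times$ and $\beta\in F$. For $k\in\{1,\dots,n\}$ and an $n$-fold quadratic Pfister form $\pi$, a $k$-fold quadratic Pfister form $\rho$ is a factor of $\pi$ if $\pi=B'\otimes\rho$ for some $(n-k)$-fold bilinear Pfister form $B'$, and a $k$-fold bilinear Pfister form $B$ is a factor of $\pi$ if $\pi=B\otimes\rho'$ for some $(n-k)$-fold quadratic Pfister form $\rho'$. Two $n$-fold quadratic Pfister forms are separably $k$-linked if some $k$-fold quadratic Pfister form is a factor of both, and totally inseparably $k$-linked if every $k$-fold bilinear Pfister form is a factor of one if and only if it is a factor of the other.
   Formalization: The forms φ and ψ are explicitly assumed non-isometric over F (''two'' read as two distinct forms); with φ = ψ every other hypothesis can hold while φ_K and ψ_K are always isometric. *)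

(* Defs.v *)
From mathcomp Require Import all_boot all_algebra ring.
From mathcomp.real_closed Require Import mxtens.

Set Implicit Arguments.
Unset Strict Implicit.
Unset Printing Implicit Defensive.

Import GRing.Theory.
Local Open Scope ring_scope.

(* A quadratic form on the row space F^N is given by a matrix M, as the map   *)
(* x |-> x M x^T.  M need not be symmetric: in characteristic 2 symmetric     *)
(* matrices do not give all quadratic forms.  Two matrices differing by an    *)
(* alternating matrix give the same form; forms are only ever compared by     *)
(* isometry, which does not see the difference.                               *)
Record quadForm (F : fieldType) := QuadForm {
  qdim : nat;
  qmx : 'M[F]_qdim
}.

Definition qeval (F : fieldType) (phi : quadForm F) (x : 'rV[F]_(qdim phi)) : F :=
  (x *m qmx phi *m x^T) 0 0.

Definition polar (F : fieldType) (phi : quadForm F)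
    (v w : 'rV[F]_(qdim phi)) : F :=
  qeval (v + w) - qeval v - qeval w.

Record symBilForm (F : fieldType) := SymBilForm {
  bdim : nat;
  bmx : 'M[F]_bdim;
  bmx_sym : bmx^T = bmx
}.

Definition beval (F : fieldType) (B : symBilForm F) (v w : 'rV[F]_(bdim B)) : F :=
  (v *m bmx B *m w^T) 0 0.

(* x |-> x *m P is bijective iff P is both row_free and row_full. *)
Definition isometric (F : fieldType) (phi psi : quadForm F) : Prop :=
  exists P : 'M[F]_(qdim phi, qdim psi),
    [/\ row_free P, row_full P &
        forall x : 'rV_(qdim phi), @qeval F psi (x *m P) = @qeval F phi x].

Definition bil_isometric (F : fieldType) (B C : symBilForm F) : Prop :=
  exists P : 'M[F]_(bdim B, bdim C),
    [/\ row_free P, row_full P &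
        forall v w : 'rV_(bdim B), @beval F C (v *m P) (w *m P) = @beval F B v w].

Definition qext (F K : fieldType) (f : {rmorphism F -> K}) (phi : quadForm F) :
    quadForm K :=
  QuadForm (map_mx f (qmx phi)).

(* (x, y) |-> a x^2 + b x y + c y^2 *)
Definition binary (F : fieldType) (a b c : F) : quadForm F :=
  @QuadForm F (1 + 1) (block_mx a%:M b%:M 0 c%:M).

Definition qsum (F : fieldType) (phi psi : quadForm F) : quadForm F :=
  QuadForm (block_mx (qmx phi) 0 0 (qmx psi)).

Definition qzero (F : fieldType) : quadForm F := @QuadForm F 0 0.

Definition hyperbolic_plane (F : fieldType) : quadForm F := binary 0 1 0.

Definition hyperbolic (F : fieldType) (phi : quadForm F) : Prop :=
  exists r : nat, isometric phi (iter r (qsum (hyperbolic_plane F)) (qzero F)).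

Lemma bdiag_sym (F : fieldType) (s : seq F) :
  let D := diag_mx (\row_(i < size s) s`_i) in D^T = D.
Proof. exact: tr_diag_mx. Qed.

(* the diagonal form <a_1, ..., a_s> *)
Definition bdiag (F : fieldType) (s : seq F) : symBilForm F :=
  SymBilForm (bdiag_sym s).

Lemma btens_sym (F : fieldType) (B C : symBilForm F) :
  (bmx B *t bmx C)^T = bmx B *t bmx C.
Proof. by rewrite trmx_tens !bmx_sym. Qed.

Definition btens (F : fieldType) (B C : symBilForm F) : symBilForm F :=
  SymBilForm (btens_sym B C).

Definition qtens (F : fieldType) (B : symBilForm F) (phi : quadForm F) :
    quadForm F :=
  QuadForm (bmx B *t qmx phi).

(* <<a_1, ..., a_r>>, with <<>> = <1> *)
Definition bpfister (F : fieldType) (s : seq F) : symBilForm F :=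
  foldr (fun a B => btens (bdiag [:: 1; a]) B) (bdiag [:: 1]) s.

Definition bil_pfister (F : fieldType) (r : nat) (B : symBilForm F) : Prop :=
  exists s : seq F, [/\ size s = r, all (fun a => a != 0) s &
                        bil_isometric B (bpfister s)].

(* There is no 0-fold quadratic Pfister form. *)
Definition quad_pfister (F : fieldType) (n : nat) (phi : quadForm F) : Prop :=
  exists (s : seq F) (b : F),
    [/\ (size s).+1 = n, all (fun a => a != 0) s &
        isometric phi (qtens (bpfister s) (binary 1 1 b))].

(* In the factor and linkage predicates the forms pi, phi, psi are meant to   *)
(* be n-fold quadratic Pfister forms and k to satisfy 1 <= k <= n.  For k = n *)
(* no bilinear form is a factor, so that total inseparable n-linkage of       *)
(* n-fold forms always holds.                                                 *)
Definition quad_factor (F : fieldType) (n k : nat) (rho pi : quadForm F) : Prop :=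
  quad_pfister k rho /\
  exists B : symBilForm F, bil_pfister (n - k) B /\ isometric pi (qtens B rho).

Definition bil_factor (F : fieldType) (n k : nat) (B : symBilForm F)
    (pi : quadForm F) : Prop :=
  bil_pfister k B /\
  exists rho : quadForm F, quad_pfister (n - k) rho /\ isometric pi (qtens B rho).

Definition separably_linked (F : fieldType) (n k : nat) (phi psi : quadForm F) :
    Prop :=
  exists rho : quadForm F, quad_factor n k rho phi /\ quad_factor n k rho psi.

Definition totally_insep_linked (F : fieldType) (n k : nat)
    (phi psi : quadForm F) : Prop :=
  forall B : symBilForm F,
    bil_pfister k B -> (bil_factor n k B phi <-> bil_factor n k B psi).

Lemma qeval_binary (F : fieldType) (a b c x y : F) :
  @qeval F (binary a b c) (row_mx x%:M y%:M : 'rV_(1 + 1)) =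
    a * x ^+ 2 + b * x * y + c * y ^+ 2.
Proof.
rewrite /qeval /= mul_row_block tr_row_mx mul_row_col !tr_scalar_mx mulmx0 addr0.
rewrite -!scalar_mxM -!raddfD /= -!scalar_mxM -!raddfD /= mxE eqxx mulr1n.
by rewrite mulrDl addrA !expr2 (mulrC x a) (mulrC x b) (mulrC y c) !mulrA.
Qed.

Lemma polarE (F : fieldType) (phi : quadForm F) (v w : 'rV[F]_(qdim phi)) :
  polar v w = (v *m (qmx phi + (qmx phi)^T) *m w^T) 0 0.
Proof.
have tr11 (M : 'M[F]_1) : M 0 0 = M^T 0 0 by rewrite mxE.
have addE (M N : 'M[F]_1) : (M + N) 0 0 = M 0 0 + N 0 0 by rewrite mxE.
rewrite /polar /qeval linearD /= !(mulmxDl, mulmxDr) !addE.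
have -> : (v *m (qmx phi)^T *m w^T) 0 0 = (w *m qmx phi *m v^T) 0 0.
  by rewrite [RHS]tr11 !trmx_mul trmxK mulmxA.
by ring.
Qed.

Lemma tens_form (F : fieldType) (m n : nat) (A : 'M[F]_m) (M : 'M[F]_n)
    (v v' : 'rV[F]_m) (w w' : 'rV[F]_n) :
  ((v *t w : 'rV_(m * n)) *m (A *t M) *m (v' *t w' : 'rV_(m * n))^T) 0 0 =
    (v *m A *m v'^T) 0 0 * (w *m M *m w'^T) 0 0.
Proof.
have E : ((v *m A *m v'^T) *t (w *m M *m w'^T)) =
         (v *t w) *m (A *t M) *m (v' *t w')^T.
  by rewrite trmx_tens !tensmx_mul.
move: (congr1 (fun X : 'M_(1 * 1, 1 * 1) => X 0 0) E) => /= <-.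
by rewrite mxE !ord1.
Qed.

Lemma qeval_tens (F : fieldType) (B : symBilForm F) (phi : quadForm F)
    (v : 'rV[F]_(bdim B)) (w : 'rV[F]_(qdim phi)) :
  @qeval F (qtens B phi) (v *t w) = beval v v * qeval w.
Proof. exact: tens_form. Qed.

Lemma polar_tens (F : fieldType) (B : symBilForm F) (phi : quadForm F)
    (v v' : 'rV[F]_(bdim B)) (w w' : 'rV[F]_(qdim phi)) :
  @polar F (qtens B phi) (v *t w) (v' *t w') = beval v v' * polar w w'.
Proof.
rewrite !polarE /= trmx_tens bmx_sym.
have -> : bmx B *t qmx phi + bmx B *t (qmx phi)^T =
          bmx B *t (qmx phi + (qmx phi)^T).
  by apply/matrixP => i j; rewrite !mxE mulrDr.
exact: tens_form.
Qed.

(* Main.v *)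
Require Import Defs.
From HB Require Import structures.
From mathcomp Require Import all_boot all_algebra all_field ring zify.
From mathcomp.real_closed Require Import mxtens.
From mathcomp Require Import generic_quotient ring_quotient.
From mathcomp Require Import boolp classical_sets filter.

Set Implicit Arguments.
Unset Strict Implicit.
Unset Printing Implicit Defensive.

Import GRing.Theory.
Local Open Scope ring_scope.

(** Write [<<s>> phi] for the tensor product of the bilinear Pfister form
    [<<s>>] with a quadratic form [phi], and [1,be] for [x^2 + xy + be y^2].
    Separable linkage gives an (n-1)-fold quadratic Pfister form [rho] and
    scalars [a], [b] such that [phi = rho + a rho] and [psi = rho + b rho].
    Call [omega = rho + ab rho] the third form.  Pfister forms are round,
    and are hyperbolic once isotropic; it follows that [phi] and [psi] are
    non-hyperbolic and non-isometric exactly when the three forms [phi], [psi],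
    [omega] are anisotropic.  So it suffices to find an extension of [F] over
    which these three stay anisotropic and [phi] and [psi] have the same bilinear
    Pfister factors, of all folds at once.

    One factor at a time.  Suppose that [<<s>>] is a factor of [psi], so that
    [psi = <<t>><<s>>[1,be]] with [t] nonempty, and that [<<c, s>>] is a factor
    of [phi].  The totally singular form [<<s>><1>] lies in [psi]; let [q] be
    its orthogonal complement.  Since [phi] is anisotropic, [c] is not a value of
    [<<s>><1>]; if it is a value of [q], then [<<c, s>>] is a factor of [psi] as
    well ([qperp_chain]).  Otherwise one passes to
    [K = E (sqrt (c q(x)))], where [E = F(x)] and [x] is a generic vector: there
    [q] represents [c].  If an anisotropic Pfister form [pi] became isotropic
    over [K], then roundness would turn an isotropic vector into a
    representation of [c q(x)] over [E] by a vector orthogonal to a given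
    vector [e] with [pi(e) = 1], and the Cassels-Pfister theorem, in a version
    that keeps track of linear constraints, would give a linear embedding of
    [c q] into the orthogonal complement of [e], over [F] ([generic_descent]).
    For [pi = phi] and [pi = omega] this is impossible because [q] has more
    than half the dimension of [psi]: a totally isotropic subspace of
    [pi + psi] that is so large forces the remaining one of the three forms to
    be isotropic ([shared_subform_isotropic]).  For [pi = psi] a dimension
    count shows that [q] represented [c] already over [F]
    ([embedding_represents]).

    All factors.  Over a fixed field, the previous step solves any finite list
    of such problems; an ultraproduct over the finite lists solves all of them
    simultaneously, because being a factor is the solvability of a system of
    polynomial equations ([all_links]).  The new field has new bilinear forms,
    so this is iterated along a tower indexed by the natural numbers.  A factor
    over the limit of the tower is defined at a finite stage and is dealt with
    at the next one ([closed_extension]). *)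

(** * Quadratic forms given by matrices over a ring *)

Notation nonzero := (all (fun a => a != 0)).

(** Values of a quadratic form and of its polar form are taken over rings, since
    forms will be evaluated on polynomial vectors and on elements of products of
    fields. *)
Definition qval (R : comNzRingType) N (A : 'M[R]_N) (x : 'rV[R]_N) : R :=
  (x *m A *m x^T) 0 0.
Definition pval (R : comNzRingType) N (A : 'M[R]_N) (x y : 'rV[R]_N) : R :=
  (x *m (A + A^T) *m y^T) 0 0.
Definition aniso (R : comNzRingType) N (A : 'M[R]_N) :=
  forall x : 'rV[R]_N, qval A x = 0 -> x = 0.

Section Values.
Variable R : comNzRingType.
Implicit Types (N : nat).

Lemma mx11_tr (M : 'M[R]_1) : M 0 0 = M^T 0 0. Proof. by rewrite mxE. Qed.

Lemma pvalE N (A : 'M[R]_N) x y :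
  pval A x y = (x *m A *m y^T) 0 0 + (y *m A *m x^T) 0 0.
Proof.
rewrite /pval mulmxDr mulmxDl mxE; congr (_ + _).
by rewrite mx11_tr !trmx_mul !trmxK mulmxA.
Qed.

Lemma pvalC N (A : 'M[R]_N) x y : pval A x y = pval A y x.
Proof. by rewrite !pvalE addrC. Qed.

Lemma pvalDl N (A : 'M[R]_N) x y z : pval A (x + y) z = pval A x z + pval A y z.
Proof. by rewrite /pval !mulmxDl mxE. Qed.

Lemma pvalZl N (A : 'M[R]_N) c x y : pval A (c *: x) y = c * pval A x y.
Proof. by rewrite /pval -!scalemxAl mxE. Qed.

Lemma pvalDr N (A : 'M[R]_N) x y z : pval A z (x + y) = pval A z x + pval A z y.
Proof. by rewrite pvalC pvalDl !(pvalC A z). Qed.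

Lemma pvalZr N (A : 'M[R]_N) c x y : pval A y (c *: x) = c * pval A y x.
Proof. by rewrite pvalC pvalZl pvalC. Qed.

Lemma pvalNl N (A : 'M[R]_N) x y : pval A (- x) y = - pval A x y.
Proof. by rewrite -scaleN1r pvalZl mulN1r. Qed.

Lemma pvalNr N (A : 'M[R]_N) x y : pval A x (- y) = - pval A x y.
Proof. by rewrite pvalC pvalNl pvalC. Qed.

Lemma pval0l N (A : 'M[R]_N) y : pval A 0 y = 0.
Proof. by rewrite /pval !mul0mx mxE. Qed.

Lemma qval0 N (A : 'M[R]_N) : qval A 0 = 0.
Proof. by rewrite /qval !mul0mx mxE. Qed.

Lemma qvalD N (A : 'M[R]_N) x y : qval A (x + y) = qval A x + qval A y + pval A x y.
Proof.
rewrite pvalE /qval linearD /= !(mulmxDl, mulmxDr) !mxE; ring.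
Qed.

Lemma qvalZ N (A : 'M[R]_N) c x : qval A (c *: x) = c ^+ 2 * qval A x.
Proof. by rewrite /qval linearZ /= -!scalemxAl -scalemxAr !mxE mulrA expr2. Qed.

Lemma qvalN N (A : 'M[R]_N) x : qval A (- x) = qval A x.
Proof. by rewrite -scaleN1r qvalZ sqrrN expr1n mul1r. Qed.

Lemma pvalxx N (A : 'M[R]_N) x : pval A x x = 2%:R * qval A x.
Proof. by rewrite pvalE mulr2n mulrDl mul1r. Qed.

Lemma qvalB N (A : 'M[R]_N) x y : qval A (x - y) = qval A x + qval A y - pval A x y.
Proof. by rewrite qvalD qvalN pvalNr. Qed.

End Values.

Lemma qval_map (R S : comNzRingType) (f : {rmorphism R -> S}) N (A : 'M[R]_N) x :
  qval (map_mx f A) (map_mx f x) = f (qval A x).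
Proof. by rewrite /qval map_trmx -!map_mxM mxE. Qed.

Lemma pval_map (R S : comNzRingType) (f : {rmorphism R -> S}) N (A : 'M[R]_N) x y :
  pval (map_mx f A) (map_mx f x) (map_mx f y) = f (pval A x y).
Proof. by rewrite /pval !map_trmx -map_mxD -!map_mxM mxE. Qed.

(** * Isometries, Pfister multiples and similarity factors *)

Section Isometry.
Variable F : fieldType.
Implicit Types (phi psi chi A B C D : quadForm F).

Lemma qevalE phi (x : 'rV_(qdim phi)) : qeval x = qval (qmx phi) x.
Proof. by []. Qed.

Lemma polar_pval phi (x y : 'rV_(qdim phi)) : polar x y = pval (qmx phi) x y.
Proof. exact: polarE. Qed.

Lemma isometricP phi psi :
  isometric phi psi <-> exists P Q, [/\ P *m Q = 1%:M, Q *m P = 1%:M &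
    forall x : 'rV_(qdim phi), qval (qmx psi) (x *m P) = qval (qmx phi) x].
Proof.
split=> [[P [/row_freeP[Q PQ] /row_fullP[Q' QP] h]]|[P [Q [PQ QP h]]]].
  exists P, Q; split=> //.
  by rewrite -[Q]mul1mx -QP -(mulmxA Q') PQ mulmx1 QP.
by exists P; split=> //; [apply/row_freeP | apply/row_fullP]; exists Q.
Qed.

Lemma isometric_mx phi psi P Q : P *m Q = 1%:M -> Q *m P = 1%:M ->
  P *m qmx psi *m P^T = qmx phi -> isometric phi psi.
Proof.
move=> PQ QP h; apply/isometricP; exists P, Q; split=> // x.
by rewrite /qval trmx_mul -h !mulmxA.
Qed.

Lemma isometric_refl phi : isometric phi phi.
Proof. by apply: (@isometric_mx _ _ 1%:M 1%:M); rewrite ?trmx1 ?mulmx1 ?mul1mx. Qed.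

Lemma isometric_sym phi psi : isometric phi psi -> isometric psi phi.
Proof.
case/isometricP=> P [Q [PQ QP h]]; apply/isometricP; exists Q, P; split=> // x.
by rewrite -h -mulmxA QP mulmx1.
Qed.

Lemma isometric_trans phi psi chi :
  isometric phi psi -> isometric psi chi -> isometric phi chi.
Proof.
case/isometricP=> P [Q [PQ QP h]] /isometricP[P' [Q' [PQ' QP' h']]].
apply/isometricP; exists (P *m P'), (Q' *m Q); split=> [||x].
- by rewrite mulmxA -(mulmxA P) PQ' mulmx1.
- by rewrite mulmxA -(mulmxA Q') QP mulmx1.
by rewrite mulmxA h' h.
Qed.

Lemma isometric_dim phi psi : isometric phi psi -> qdim phi = qdim psi.
Proof. by case=> P [/eqP r1 /eqP r2 _]; rewrite -[LHS]r1. Qed.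

Lemma isometric_pval phi psi (P : 'M_(qdim phi, qdim psi)) :
  (forall x, qval (qmx psi) (x *m P) = qval (qmx phi) x) ->
  forall x y, pval (qmx psi) (x *m P) (y *m P) = pval (qmx phi) x y.
Proof. by move=> h x y; rewrite -!polar_pval /polar -!mulmxDl !qevalE !h. Qed.

Definition nondeg phi := row_free (qmx phi + (qmx phi)^T).

Lemma nondegP phi : nondeg phi <->
  forall x, (forall y, pval (qmx phi) x y = 0) -> x = 0.
Proof.
split=> [nd x x0|h].
  apply: (row_free_inj nd); rewrite mul0mx; apply/rowP => j; rewrite [RHS]mxE.
  have := x0 (delta_mx 0 j); rewrite /pval trmx_delta -colE mxE => <-.
  by [].
rewrite /nondeg -kermx_eq0; apply/rowV0P => x /sub_kermxP x0; apply: h => y.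
by rewrite /pval x0 mul0mx mxE.
Qed.

(** A value-preserving map out of a nondegenerate form is injective, as its
    kernel is orthogonal to everything. *)
Lemma isometric_of_nondeg phi psi (P : 'M_(qdim phi, qdim psi)) :
  nondeg phi -> qdim phi = qdim psi ->
  (forall x, qval (qmx psi) (x *m P) = qval (qmx phi) x) -> isometric phi psi.
Proof.
move=> /nondegP nd dimE h.
have Pfree : row_free P.
  rewrite -kermx_eq0; apply/rowV0P => x /sub_kermxP x0; apply: nd => y.
  by rewrite -(isometric_pval h) x0 pval0l.
exists P; split=> //; apply/eqP.
exact: etrans (eqP Pfree) dimE.
Qed.

Definition qscale c phi : quadForm F := QuadForm (c *: qmx phi).
(** [qdbl a phi] is the form [<<a>> phi]; iterating it gives a model of the
    tensor product with a bilinear Pfister form that involves no tensor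
    products. *)
Definition qdbl a phi : quadForm F := qsum phi (qscale a phi).
Definition pfister s chi : quadForm F := foldr qdbl chi s.

Lemma qval_scale (c : F) n (A : 'M[F]_n) x : qval (c *: A) x = c * qval A x.
Proof. by rewrite /qval -scalemxAr -scalemxAl mxE. Qed.

Lemma qval_block m n (A : 'M[F]_m) (B : 'M[F]_n) (x : 'rV[F]_m) (y : 'rV_n) :
  qval (block_mx A 0 0 B) (row_mx x y) = qval A x + qval B y.
Proof.
rewrite /qval mul_row_block !mulmx0 addr0 add0r tr_row_mx mul_row_col.
by rewrite [LHS]mxE.
Qed.

Lemma qval_dbl a phi (x y : 'rV_(qdim phi)) :
  qval (qmx (qdbl a phi)) (row_mx x y : 'rV_(_ + _)) =
  qval (qmx phi) x + a * qval (qmx phi) y.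
Proof. by rewrite qval_block qval_scale. Qed.

Lemma qscaleA c d phi : qscale c (qscale d phi) = qscale (c * d) phi.
Proof. by rewrite /qscale /= scalerA. Qed.

Lemma qscale1 phi : qscale 1 phi = phi.
Proof. by case: phi => n A; rewrite /qscale /= scale1r. Qed.

Lemma qscale_sum c phi psi : qscale c (qsum phi psi) = qsum (qscale c phi) (qscale c psi).
Proof. by rewrite /qscale /qsum /= scale_block_mx !scaler0. Qed.

Lemma qscale_dbl c a phi : qscale c (qdbl a phi) = qdbl a (qscale c phi).
Proof. by rewrite qscale_sum !qscaleA mulrC /qdbl qscaleA. Qed.

Lemma pfister_cat s t phi : pfister (s ++ t) phi = pfister s (pfister t phi).
Proof. by rewrite /pfister foldr_cat. Qed.

Lemma isometric_scale c phi psi :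
  isometric phi psi -> isometric (qscale c phi) (qscale c psi).
Proof.
case/isometricP=> P [Q [PQ QP h]]; apply/isometricP; exists P, Q; split=> // x.
by rewrite !qval_scale h.
Qed.

Lemma isometric_sum phi phi' psi psi' : isometric phi phi' -> isometric psi psi' ->
  isometric (qsum phi psi) (qsum phi' psi').
Proof.
case/isometricP=> P [Q [PQ QP h]] /isometricP[P' [Q' [PQ' QP' h']]].
apply/isometricP; exists (block_mx P 0 0 P'), (block_mx Q 0 0 Q'); split.
- by rewrite mulmx_block !(mulmx0, mul0mx, addr0, add0r) PQ PQ' -scalar_mx_block.
- by rewrite mulmx_block !(mulmx0, mul0mx, addr0, add0r) QP QP' -scalar_mx_block.
move=> x; rewrite -[x](@hsubmxK _ 1 (qdim phi) (qdim psi)) mul_row_block.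
by rewrite !mulmx0 addr0 add0r !qval_block h h'.
Qed.

Lemma isometric_dbl a phi psi :
  isometric phi psi -> isometric (qdbl a phi) (qdbl a psi).
Proof. by move=> h; apply: isometric_sum => //; apply: isometric_scale. Qed.

Lemma isometric_pfister s phi psi :
  isometric phi psi -> isometric (pfister s phi) (pfister s psi).
Proof. by move=> h; elim: s => //= a s IHs; apply: isometric_dbl. Qed.

Lemma qsumC phi psi : isometric (qsum phi psi) (qsum psi phi).
Proof.
apply: (@isometric_mx (qsum phi psi) (qsum psi phi)
  (block_mx 0 1%:M 1%:M 0) (block_mx 0 1%:M 1%:M 0)) => /=.
- by rewrite mulmx_block !(mulmx0, mul0mx, mulmx1, addr0, add0r) -scalar_mx_block.
- by rewrite mulmx_block !(mulmx0, mul0mx, mulmx1, addr0, add0r) -scalar_mx_block.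
rewrite tr_block_mx !trmx0 !trmx1.
by rewrite !mulmx_block !(mulmx0, mul0mx, mulmx1, mul1mx, addr0, add0r).
Qed.

(** Exchanging the two middle summands; commutativity of the slots of a Pfister
    form is a special case. *)
Lemma qsumACA (A B C D : quadForm F) :
  isometric (qsum (qsum A B) (qsum C D)) (qsum (qsum A C) (qsum B D)).
Proof.
pose P a b c d : 'M[F]_((a + b) + (c + d), (a + c) + (b + d)) := block_mx
  (block_mx 1%:M 0 0 0) (block_mx 0 0 1%:M 0)
  (block_mx 0 1%:M 0 0) (block_mx 0 0 0 1%:M).
have PP a b c d : P a b c d *m P a c b d = 1%:M.
  rewrite /P !mulmx_block !(mulmx0, mul0mx, mulmx1, addr0, add0r).
  rewrite !add_block_mx !(mulmx0, mul0mx, mulmx1, addr0, add0r).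
  by rewrite !block_mx0 -!scalar_mx_block.
apply: (@isometric_mx (qsum (qsum A B) (qsum C D)) (qsum (qsum A C) (qsum B D))
  (P _ _ _ _) (P _ _ _ _)) => //=.
rewrite /P !tr_block_mx !trmx0 !trmx1.
rewrite !mulmx_block !(mulmx0, mul0mx, mulmx1, mul1mx, addr0, add0r).
rewrite !mulmx_block !(mulmx0, mul0mx, mulmx1, mul1mx, addr0, add0r).
by rewrite !add_block_mx !(mulmx0, mul0mx, mulmx1, mul1mx, addr0, add0r) !block_mx0.
Qed.

Lemma qsum0l C : isometric (qsum (qzero F) C) C.
Proof.
pose I1 : 'M[F]_(qdim C) := 1%:M.
apply: (@isometric_mx (qsum (qzero F) C) C I1 I1); rewrite ?[LHS]mulmx1 //.
rewrite trmx1 mulmx1 [LHS]mul1mx; apply/matrixP => i j; rewrite /= !mxE.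
case: splitP => [[]//|k ik]; rewrite !mxE; case: splitP => [[]//|l jl]; rewrite ?mxE.
by congr (qmx C _ _); apply: val_inj.
Qed.

Lemma qsum0r C : isometric (qsum C (qzero F)) C.
Proof. exact: isometric_trans (qsumC _ _) (qsum0l _). Qed.

Lemma qsumA A B C : isometric (qsum A (qsum B C)) (qsum (qsum A B) C).
Proof.
have h1 := isometric_sum (isometric_sym (qsum0r A)) (isometric_refl (qsum B C)).
apply: isometric_trans h1 _; apply: isometric_trans (qsumACA _ _ _ _) _.
exact: isometric_sum (isometric_refl _) (qsum0l _).
Qed.

Lemma qdblC a b C : isometric (qdbl a (qdbl b C)) (qdbl b (qdbl a C)).
Proof.
rewrite /qdbl !qscale_sum !qscaleA (mulrC b).
exact: qsumACA.
Qed.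

Lemma pfister_dblC a s chi : isometric (pfister s (qdbl a chi)) (qdbl a (pfister s chi)).
Proof.
elim: s => [|b s IHs]; first exact: isometric_refl.
exact: isometric_trans (isometric_dbl b IHs) (qdblC _ _ _).
Qed.

Lemma pfisterC s t chi :
  isometric (pfister s (pfister t chi)) (pfister t (pfister s chi)).
Proof.
elim: t => [|a t IHt]; first exact: isometric_refl.
apply: isometric_trans (pfister_dblC _ _ _) _.
exact: isometric_dbl IHt.
Qed.

Lemma qscale_sqr c phi : c != 0 -> isometric phi (qscale (c ^+ 2) phi).
Proof.
move=> c0; apply/isometric_sym/isometricP; exists c%:M, (c^-1)%:M; split.
- by rewrite -scalar_mxM divff.
- by rewrite -scalar_mxM mulVf.
by move=> x; rewrite mul_mx_scalar qvalZ qval_scale.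
Qed.

Lemma qdim_pfister s chi : qdim (pfister s chi) = (2 ^ size s * qdim chi)%N.
Proof. by elim: s => [|a s /= ->]; rewrite ?mul1n // expnS -mulnA mul2n -addnn. Qed.

Definition simfactor phi c := isometric phi (qscale c phi).

Lemma simfactor_mul phi c d : simfactor phi c -> simfactor phi d -> simfactor phi (c * d).
Proof.
move=> hc hd; apply: isometric_trans hc _.
by rewrite -qscaleA; apply: isometric_scale.
Qed.

Lemma simfactor_sqr phi c : c != 0 -> simfactor phi (c ^+ 2). Proof. exact: qscale_sqr. Qed.

(** Squares are similarity factors, so [1/c = (1/c)^2 c] is one. *)
Lemma simfactor_inv phi c : c != 0 -> simfactor phi c -> simfactor phi c^-1.
Proof.
move=> c0 hc; have -> : c^-1 = c^-1 ^+ 2 * c by rewrite expr2 mulfVK.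
by apply: simfactor_mul => //; apply: simfactor_sqr; rewrite invr_eq0.
Qed.

Lemma simfactor_scale phi a c : simfactor phi c ->
  isometric (qscale a phi) (qscale (a * c) phi).
Proof. by move=> hc; rewrite -qscaleA; apply: isometric_scale. Qed.

Lemma qdbl_simfactor phi a c : simfactor phi c -> isometric (qdbl a phi) (qdbl (a * c) phi).
Proof. by move=> hc; apply: isometric_sum (isometric_refl _) (simfactor_scale _ hc). Qed.

(** The bilinear identity [<x, y> = <x + y, xy(x + y)>]: in the plane [<x, y>]
    the vectors [(1, 1)] and [(y, -x)] are orthogonal. *)
Lemma binary_bil x y C : x + y != 0 ->
  isometric (qsum (qscale x C) (qscale y C))
            (qsum (qscale (x + y) C) (qscale ((x + y) * (x * y)) C)).
Proof.
move=> xy0; apply: isometric_sym.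
apply: (@isometric_mx (qsum (qscale (x + y) C) (qscale ((x + y) * (x * y)) C))
  (qsum (qscale x C) (qscale y C)) (block_mx 1%:M 1%:M y%:M (- x)%:M)
  ((x + y)^-1 *: block_mx x%:M 1%:M y%:M (- 1)%:M)) => /=.
- rewrite -scalemxAr mulmx_block -!scalar_mxM -!raddfD /=.
  rewrite scale_block_mx !scale_scalar_mx [RHS]scalar_mx_block.
  by congr block_mx; rewrite -?[RHS](raddf0 scalar_mx); congr (_%:M); field.
- rewrite -scalemxAl mulmx_block -!scalar_mxM -!raddfD /=.
  rewrite scale_block_mx !scale_scalar_mx [RHS]scalar_mx_block.
  by congr block_mx; rewrite -?[RHS](raddf0 scalar_mx); congr (_%:M); field.
rewrite tr_block_mx !tr_scalar_mx !mulmx_block !mulmx0 !addr0 !add0r !mul1mx !mulmx1.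
rewrite !mul_scalar_mx !mul_mx_scalar !scalerA -!scalerDl.
congr block_mx; [| |]; last by congr (_ *: _); ring.
  by rewrite mulNr (mulrC y) subrr scale0r.
by rewrite mulNr (mulrC y) subrr scale0r.
Qed.

(** The induction step for roundness: if [e1] and [e2] are similarity factors
    of [C], then [C + a C] becomes [e1 C + a e2 C], to which [binary_bil]
    applies.  A vanishing [ei] is allowed, as it is the value of a zero
    component. *)
Lemma simfactor_dbl C a e1 e2 : a != 0 -> e1 + a * e2 != 0 ->
  (e1 != 0 -> simfactor C e1) -> (e2 != 0 -> simfactor C e2) ->
  simfactor (qdbl a C) (e1 + a * e2).
Proof.
move=> a0; have [->|e1_0] := eqVneq e1 0.
  rewrite add0r mulf_eq0 (negPf a0) /= => e2_0 _ /(_ e2_0) h2.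
  rewrite /simfactor /qdbl qscale_sum qscaleA.
  apply: isometric_trans (qsumC _ _) (isometric_sum (simfactor_scale _ h2) _).
  have -> : a * e2 * a = a ^+ 2 * e2 by ring.
  by apply: simfactor_mul => //; apply: simfactor_sqr.
have [->|e2_0] := eqVneq e2 0.
  rewrite mulr0 addr0 => _ /(_ isT) h1 _.
  rewrite /simfactor /qdbl qscale_sum qscaleA (mulrC e1).
  exact: isometric_sum h1 (simfactor_scale _ h1).
move=> e0 /(_ isT) h1 /(_ isT) h2.
rewrite /simfactor; set e := _ + _ in e0 *.
apply: isometric_trans (isometric_sum h1 (simfactor_scale a h2)) _.
apply: isometric_trans (binary_bil _ e0) _; rewrite -/e /qdbl qscale_sum qscaleA.
apply: isometric_sum; first exact: isometric_refl.
apply: isometric_sym.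
have -> : e * (e1 * (a * e2)) = e * a * (e1 * e2) by ring.
by apply: simfactor_scale; apply: simfactor_mul.
Qed.

(** [<<x, y>> = <<x + y, xy>>]. *)
Lemma qdbl_linkage x y C : x + y != 0 ->
  isometric (qdbl x (qdbl y C)) (qdbl (x + y) (qdbl (x * y) C)).
Proof.
move=> xy0; rewrite /qdbl !qscale_sum !qscaleA.
apply: isometric_trans (isometric_sum (isometric_refl _) (qsumC _ _)) _.
apply: isometric_trans (qsumACA _ _ _ _) _.
apply: isometric_sum; first exact: isometric_refl.
apply: isometric_trans (qsumC _ _) _.
exact: binary_bil.
Qed.

Lemma qval_binary (a b c x y : F) :
  qval (qmx (binary a b c)) (row_mx x%:M y%:M : 'rV_(1 + 1)) =
    a * x ^+ 2 + b * x * y + c * y ^+ 2.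
Proof. exact: qeval_binary. Qed.

Lemma row2 (x : 'rV[F]_(1 + 1)) : exists u v, x = row_mx u%:M v%:M.
Proof.
exists (lsubmx x 0 0), (rsubmx x 0 0).
by rewrite -!mx11_scalar hsubmxK.
Qed.

Lemma row2M (a b c d u v : F) :
  row_mx u%:M v%:M *m block_mx a%:M b%:M c%:M d%:M =
  row_mx (u * a + v * c)%:M (u * b + v * d)%:M :> 'rV[F]_(1 + 1).
Proof. by rewrite mul_row_block -!scalar_mxM -!raddfD. Qed.

(** [1,be] is the norm form of a quadratic algebra, and multiplication by the
    element with coordinates [x], [y] is a similitude. *)
Lemma simfactor_binary be x y : x ^+ 2 + x * y + be * y ^+ 2 != 0 ->
  simfactor (binary 1 1 be) (x ^+ 2 + x * y + be * y ^+ 2).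
Proof.
set e := _ + _ => e0; apply/isometric_sym/isometricP.
exists (block_mx x%:M y%:M (- (be * y))%:M (x + y)%:M).
exists (e^-1 *: block_mx (x + y)%:M (- y)%:M (be * y)%:M x%:M); split.
- rewrite -scalemxAr mulmx_block -!scalar_mxM -!raddfD /=.
  rewrite scale_block_mx !scale_scalar_mx [RHS]scalar_mx_block.
  by congr block_mx; rewrite -?[RHS](raddf0 scalar_mx); congr (_%:M); rewrite /e; field.
- rewrite -scalemxAl mulmx_block -!scalar_mxM -!raddfD /=.
  rewrite scale_block_mx !scale_scalar_mx [RHS]scalar_mx_block.
  by congr block_mx; rewrite -?[RHS](raddf0 scalar_mx); congr (_%:M); rewrite /e; field.
move=> z; have [u [v ->]] := row2 z.
by rewrite row2M qval_scale !qval_binary /e; ring.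
Qed.

Lemma pfister_round s be x : nonzero s ->
  qval (qmx (pfister s (binary 1 1 be))) x != 0 ->
  simfactor (pfister s (binary 1 1 be)) (qval (qmx (pfister s (binary 1 1 be))) x).
Proof.
elim: s x => [|a s IHs] x /=.
  move=> _; have [u [v ->]] := row2 x; rewrite qval_binary !mul1r.
  exact: simfactor_binary.
case/andP=> a0 s0; rewrite -[x](@hsubmxK _ 1 (qdim _) (qdim _)) qval_dbl => e0.
by apply: simfactor_dbl => // h; apply: IHs.
Qed.

Definition qone : quadForm F := @QuadForm F 1 1%:M.

Lemma qval_one (x : 'rV_1) : qval (qmx qone) x = x 0 0 ^+ 2.
Proof. by rewrite /qval mulmx1 mxE big_ord1 mxE expr2. Qed.

(** Roundness of the bilinear form [<<s>>], seen through the similarity factors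
    of its products with quadratic forms; its values are those of the quadratic
    form [<<s>><1>]. *)
Lemma pfister_bilinear_round s chi x : nonzero s ->
  qval (qmx (pfister s qone)) x != 0 ->
  simfactor (pfister s chi) (qval (qmx (pfister s qone)) x).
Proof.
elim: s x => [|a s IHs] x /=.
  by rewrite qval_one sqrf_eq0 => _; apply: simfactor_sqr.
case/andP=> a0 s0; rewrite -[x](@hsubmxK _ 1 (qdim _) (qdim _)) qval_dbl => e0.
by apply: simfactor_dbl => // h; apply: IHs.
Qed.
End Isometry.

(** * Characteristic two *)

Section CharTwo.
Variable F : fieldType.
Hypothesis F2 : 2%N \in [pchar F].
Implicit Types (phi psi chi A B C D : quadForm F).

Let two : 2%:R = 0 :> F. Proof. exact: pcharf0. Qed.

(** Reduces an identity modulo 2 to an identity over the integers, with an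
    explicit multiple of 2. *)
Lemma eq_mod2 (x y z : F) : x - y = 2%:R * z -> x = y.
Proof. by rewrite two mul0r => /eqP; rewrite subr_eq0 => /eqP. Qed.

Lemma pval_qval n (M : 'M[F]_n) x y : pval M x y = qval M (x + y) - qval M x - qval M y.
Proof. by rewrite qvalD; ring. Qed.

Lemma pval_block m n (A : 'M[F]_m) (B : 'M[F]_n) (x x' : 'rV[F]_m) (y y' : 'rV[F]_n) :
  pval (block_mx A 0 0 B) (row_mx x y) (row_mx x' y') = pval A x x' + pval B y y'.
Proof. by rewrite !pval_qval add_row_mx !qval_block; ring. Qed.

Lemma pval_scale (c : F) n (M : 'M[F]_n) x y : pval (c *: M) x y = c * pval M x y.
Proof. by rewrite !pval_qval !qval_scale; ring. Qed.

Lemma nondeg_sum phi psi : nondeg phi -> nondeg psi -> nondeg (qsum phi psi).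
Proof.
move=> /nondegP n1 /nondegP n2; apply/nondegP => x.
rewrite -[x](@hsubmxK _ 1 (qdim phi) (qdim psi)) => h.
have -> : lsubmx (x : 'rV_(_ + _)) = 0.
  apply: n1 => y; have := h (row_mx y 0).
  by rewrite pval_block (pvalC _ _ 0) pval0l addr0.
have -> : rsubmx (x : 'rV_(_ + _)) = 0.
  apply: n2 => y; have := h (row_mx 0 y).
  by rewrite pval_block (pvalC _ _ 0) pval0l add0r.
exact: row_mx0.
Qed.

Lemma nondeg_scale c phi : c != 0 -> nondeg phi -> nondeg (qscale c phi).
Proof.
move=> c0 /nondegP n1; apply/nondegP => x h; apply: n1 => y.
by apply: (mulfI c0); rewrite -pval_scale h mulr0.
Qed.

Lemma pval_binary (be u v u' v' : F) :
  pval (qmx (binary 1 1 be)) (row_mx u%:M v%:M : 'rV_(1 + 1)) (row_mx u'%:M v'%:M : 'rV_(1 + 1))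
    = u * v' + v * u'.
Proof.
rewrite pval_qval add_row_mx -!raddfD !qval_binary.
by apply: (@eq_mod2 _ _ (u * u' + be * v * v')); ring.
Qed.

Lemma nondeg_binary (be : F) : nondeg (binary 1 1 be).
Proof.
apply/nondegP => x; have [u [v ->]] := row2 x => h.
have := h (row_mx 0%:M 1%:M); rewrite pval_binary mulr1 mulr0 addr0 => ->.
have := h (row_mx 1%:M 0%:M); rewrite pval_binary mulr1 mulr0 add0r => ->.
by rewrite raddf0 row_mx0.
Qed.

Lemma nondeg_pfister s chi : nonzero s -> nondeg chi ->
  nondeg (pfister s chi).
Proof.
elim: s => //= a s IHs /andP[a0 s0] nd.
by apply: nondeg_sum; [|apply: nondeg_scale]; rewrite ?IHs.
Qed.

Lemma row4 (x : 'rV[F]_((1 + 1) + (1 + 1))) :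
  exists u v p q, x = row_mx (row_mx u%:M v%:M) (row_mx p%:M q%:M).
Proof.
have [u [v E1]] := row2 (lsubmx x); have [p [q E2]] := row2 (rsubmx x).
by exists u, v, p, q; rewrite -E1 -E2 hsubmxK.
Qed.

Lemma row4M (a b c d a' b' c' d' k l m n k' l' m' n' u v p q : F) :
  row_mx (row_mx u%:M v%:M) (row_mx p%:M q%:M) *m
    block_mx (block_mx a%:M b%:M c%:M d%:M) (block_mx a'%:M b'%:M c'%:M d'%:M)
             (block_mx k%:M l%:M m%:M n%:M) (block_mx k'%:M l'%:M m'%:M n'%:M) =
  row_mx (row_mx (u * a + v * c + (p * k + q * m))%:M (u * b + v * d + (p * l + q * n))%:M)
    (row_mx (u * a' + v * c' + (p * k' + q * m'))%:M (u * b' + v * d' + (p * l' + q * n'))%:M)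
  :> 'rV[F]_((1 + 1) + (1 + 1)).
Proof. by rewrite mul_row_block !row2M !add_row_mx -!raddfD. Qed.

(** In the basis [1], [w], [j], [j w] of [1,be] + y [1,be], the vector [1 + j]
    has value [y + 1] and is orthogonal to [1] and to [w + j w / y]. *)
Lemma qdbl_shift (y be : F) : y != 0 -> y + 1 != 0 ->
  isometric (qdbl (y + 1) (binary 1 1 (be * (y + 1) / y))) (qdbl y (binary 1 1 be)).
Proof.
move=> y0 y1.
pose P : 'M[F]_((1 + 1) + (1 + 1)) := block_mx
  (block_mx 1%:M 0%:M 0%:M 1%:M) (block_mx 0%:M 0%:M 0%:M (y^-1)%:M)
  (block_mx 1%:M 0%:M 0%:M 0%:M) (block_mx 1%:M 0%:M 0%:M ((y + 1) / y)%:M).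
apply: (@isometric_of_nondeg _ (qdbl (y + 1) (binary 1 1 (be * (y + 1) / y)))
                             (qdbl y (binary 1 1 be)) P) => //.
  by apply: nondeg_sum; [|apply: nondeg_scale => //]; apply: nondeg_binary.
move=> x; have [u [v [p [q ->]]]] := row4 x; rewrite row4M !qval_block !qval_scale !qval_binary.
by apply: (@eq_mod2 _ _ (u * p + p * v + be * v * q * (y + 1) / y)); field.
Qed.

Local Notation H := (hyperbolic_plane F).

Lemma hyperbolic_iso phi psi : isometric phi psi -> hyperbolic psi -> hyperbolic phi.
Proof. by move=> h [r hr]; exists r; apply: isometric_trans h hr. Qed.

Lemma hyperbolic_sum phi psi : hyperbolic phi -> hyperbolic psi -> hyperbolic (qsum phi psi).
Proof.
move=> [r hr] [r' hr']; exists (r + r')%N.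
apply: isometric_trans (isometric_sum hr hr') _; elim: r {hr} => [|r IHr] /=.
  exact: qsum0l.
apply: isometric_trans (isometric_sym (qsumA _ _ _)) _.
exact: isometric_sum (isometric_refl _) IHr.
Qed.

Lemma nondeg_plane : nondeg H.
Proof.
apply/nondegP => x; have [u [v ->]] := row2 x => h.
have := h (row_mx 0%:M 1%:M); have := h (row_mx 1%:M 0%:M).
rewrite !pval_qval !add_row_mx -!raddfD !qval_binary => E1 E2.
have -> : v = 0 by rewrite -E1; ring.
have -> : u = 0 by rewrite -E2; ring.
by rewrite raddf0 row_mx0.
Qed.

Lemma hyperbolic_plane_hyp : hyperbolic H.
Proof. by exists 1%N; apply/isometric_sym/qsum0r. Qed.

Lemma hyperbolic_scale c phi : c != 0 -> hyperbolic phi -> hyperbolic (qscale c phi).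
Proof.
move=> c0 [r hr]; apply: hyperbolic_iso (isometric_scale c hr) _.
elim: r {hr} => [|r IHr] /=.
  exists 0%N => /=; rewrite /qscale /= (_ : c *: 0 = 0) ?scaler0 //; exact: isometric_refl.
rewrite qscale_sum; apply: hyperbolic_sum => //.
apply: hyperbolic_iso hyperbolic_plane_hyp; apply: isometric_sym.
apply: (@isometric_of_nondeg _ H (qscale c H)
          (block_mx 1%:M 0%:M 0%:M (c^-1)%:M : 'M_(1 + 1))) => //.
  exact: nondeg_plane.
move=> x; have [u [v ->]] := row2 x; rewrite row2M qval_scale !qval_binary.
by field.
Qed.

Lemma hyperbolic_pfister s phi : nonzero s -> hyperbolic phi ->
  hyperbolic (pfister s phi).
Proof.
elim: s => //= a s IHs /andP[a0 s0] hphi.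
by apply: hyperbolic_sum; [|apply: hyperbolic_scale => //]; apply: IHs.
Qed.

(** In the sum of two copies of [1,be], the diagonal is totally isotropic of
    half the dimension; the matrix completes it to a hyperbolic basis. *)
Lemma hyperbolic_double (be : F) : hyperbolic (qdbl 1 (binary 1 1 be)).
Proof.
pose P : 'M[F]_((1 + 1) + (1 + 1)) := block_mx
  (block_mx 1%:M 0%:M be%:M 0%:M) (block_mx 1%:M 0%:M be%:M 1%:M)
  (block_mx 0%:M 1%:M 1%:M 1%:M) (block_mx 0%:M 1%:M 0%:M 1%:M).
apply: hyperbolic_iso (hyperbolic_sum hyperbolic_plane_hyp hyperbolic_plane_hyp).
apply: isometric_sym.
apply: (@isometric_of_nondeg _ (qsum H H) (qdbl 1 (binary 1 1 be)) P) => //.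
  by apply: nondeg_sum; apply: nondeg_plane.
move=> x; have [u [v [p [q ->]]]] := row4 x; rewrite row4M !qval_block !qval_scale !qval_binary.
set s := u + be * v.
apply: (@eq_mod2 _ _ (s ^+ 2 + 2%:R * s * q + q ^+ 2 + s * p + be * (p + q) ^+ 2 +
  be * v ^+ 2 + be * v * (p + q))).
by rewrite /s; ring.
Qed.

Lemma not_aniso n (M : 'M[F]_n) : ~ aniso M -> exists2 x, x != 0 & qval M x = 0.
Proof.
move=> h; have [//|none] := pselect (exists2 x, x != 0 & qval M x = 0).
case: h => x x0; apply/eqP/negPn/negP => xn0; apply: none.
by exists x.
Qed.

(** An isotropic vector of [C + a C] exhibits [a] as a quotient of two values of
    the round form [C]. *)
Lemma isotropic_dbl_simfactor C a : a != 0 -> aniso (qmx C) ->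
  (forall x, qval (qmx C) x != 0 -> simfactor C (qval (qmx C) x)) ->
  ~ aniso (qmx (qdbl a C)) -> simfactor C a.
Proof.
move=> a0 anC rnd /not_aniso[x].
rewrite -[x](@hsubmxK _ 1 (qdim _) (qdim _)); move: (lsubmx _) (rsubmx _) => {x} x y.
rewrite qval_dbl => nz E0.
have y0 : qval (qmx C) y != 0.
  apply: contra_neq nz => /anC y0; move: E0; rewrite y0 qval0 mulr0 addr0 => /anC ->.
  exact: row_mx0.
have Ea : a = qval (qmx C) x * (qval (qmx C) y)^-1.
  apply: (mulIf y0); rewrite mulfVK //; apply: (@eq_mod2 _ _ (- qval (qmx C) x)).
  by rewrite -[RHS]addr0 -E0; ring.
have x0 : qval (qmx C) x != 0 by apply: contra_neq a0 => x0; rewrite Ea x0 mul0r.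
by rewrite Ea; apply: simfactor_mul; [|apply: simfactor_inv => //]; apply: rnd.
Qed.

(** If [C] is anisotropic and [<<a>> C] is not, then [a C = C], so that
    [<<a>> C = C + C], which is hyperbolic in characteristic 2. *)
Lemma pfister_isotropic_hyperbolic s (be : F) : nonzero s ->
  ~ aniso (qmx (pfister s (binary 1 1 be))) -> hyperbolic (pfister s (binary 1 1 be)).
Proof.
elim: s => [_ /not_aniso[x]|a s IHs /= /andP[a0 s0] not_an].
  have [u [v ->]] := row2 x; rewrite qval_binary => nz E0.
  have v0 : v != 0.
    apply: contra_neq nz => v0; move: E0; rewrite v0 expr0n /= !mulr0 !addr0 mul1r.
    by move/eqP; rewrite sqrf_eq0 => /eqP ->; rewrite raddf0 row_mx0.
  apply: hyperbolic_iso hyperbolic_plane_hyp.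
  pose w := u / v.
  have bew : be = - (w ^+ 2 + w).
    apply: (mulIf (expf_neq0 2 v0)); apply/eqP; rewrite -subr_eq0; apply/eqP.
    by rewrite -[RHS]E0 /w; field.
  apply: (@isometric_of_nondeg _ (binary 1 1 be) H
     (block_mx 1%:M 1%:M w%:M (w + 1)%:M : 'M_(1 + 1))) => //.
    exact: nondeg_binary.
  move=> y; have [p [q ->]] := row2 y; rewrite row2M !qval_binary.
  by apply: (@eq_mod2 _ _ (q ^+ 2 * (w ^+ 2 + w) + p * q * w)); rewrite bew; ring.
set C := pfister s _ in IHs not_an *.
have [anC|/IHs hC] := pselect (aniso (qmx C)); last first.
  by apply: hyperbolic_sum; [|apply: hyperbolic_scale => //]; apply: hC.
have simCa : simfactor C a.
  by apply: isotropic_dbl_simfactor anC _ not_an => // x; apply: pfister_round.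
apply: hyperbolic_iso (_ : hyperbolic (qdbl 1 C)).
  rewrite /qdbl qscale1; apply: isometric_sum; first exact: isometric_refl.
  exact: isometric_sym.
apply: hyperbolic_iso (isometric_sym (pfister_dblC _ _ _)) _.
exact: hyperbolic_pfister (hyperbolic_double _).
Qed.

Definition subform phi psi := exists2 P : 'M_(qdim phi, qdim psi), row_free P &
  forall x, qval (qmx psi) (x *m P) = qval (qmx phi) x.

Lemma subform_iso phi psi : isometric phi psi -> subform phi psi.
Proof. by case=> P [Pf _ h]; exists P. Qed.

Lemma subform_trans phi psi chi : subform phi psi -> subform psi chi -> subform phi chi.
Proof.
move=> [P Pf h] [P' Pf' h']; exists (P *m P'); last by move=> x; rewrite mulmxA h' h.
by rewrite /row_free mxrankMfree.
Qed.

Lemma row_free_block m n m' n' (P : 'M[F]_(m, n)) (P' : 'M[F]_(m', n')) :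
  row_free P -> row_free P' -> row_free (block_mx P 0 0 P').
Proof.
move=> /row_freeP[Q PQ] /row_freeP[Q' PQ']; apply/row_freeP.
exists (block_mx Q 0 0 Q').
by rewrite mulmx_block !(mulmx0, mul0mx, addr0, add0r) PQ PQ' -scalar_mx_block.
Qed.

Lemma subform_sum phi phi' psi psi' : subform phi phi' -> subform psi psi' ->
  subform (qsum phi psi) (qsum phi' psi').
Proof.
move=> [P Pf h] [P' Pf' h']; exists (block_mx P 0 0 P'); first exact: row_free_block.
move=> x; rewrite -[x](@hsubmxK _ 1 (qdim phi) (qdim psi)) mul_row_block.
by rewrite !mulmx0 addr0 add0r !qval_block h h'.
Qed.

Lemma subform_scale c phi psi : subform phi psi -> subform (qscale c phi) (qscale c psi).
Proof. by move=> [P Pf h]; exists P => // x; rewrite !qval_scale h. Qed.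

Lemma subform_pfister s phi psi : subform phi psi -> subform (pfister s phi) (pfister s psi).
Proof.
move=> h; elim: s => //= a s IHs.
by apply: subform_sum => //; apply: subform_scale.
Qed.

Lemma subform_aniso phi psi : subform phi psi -> aniso (qmx psi) -> aniso (qmx phi).
Proof.
move=> [P Pf h] an x x0; apply: (row_free_inj Pf); rewrite mul0mx.
by apply: an; rewrite h.
Qed.

Lemma isometric_aniso phi psi : isometric phi psi -> aniso (qmx psi) -> aniso (qmx phi).
Proof. by move/subform_iso; apply: subform_aniso. Qed.

Lemma aniso_not_hyperbolic phi : aniso (qmx phi) -> (0 < qdim phi)%N -> ~ hyperbolic phi.
Proof.
move=> an d0 [[|r] /= h]; first by rewrite (isometric_dim h) in d0.
have := isometric_aniso (isometric_sym h) an.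
move/(_ (row_mx (row_mx 1%:M 0%:M : 'rV_(1 + 1)) 0)); rewrite qval_block qval_binary qval0.
rewrite !mul0r !mulr0 !addr0 => /(_ erefl) /rowP/(_ (lshift _ 0)).
rewrite row_mxEl -(lshift0 1 0) row_mxEl !mxE => /eqP.
by rewrite oner_eq0.
Qed.

Lemma subform_one (be : F) : subform (qone F) (binary 1 1 be).
Proof.
exists (row_mx 1%:M 0 : 'M_(1, 1 + 1)).
  by apply/row_freeP; exists (col_mx 1%:M 0); rewrite mul_row_col mul0mx addr0 mulmx1.
move=> x; rewrite mul_mx_row mulmx1 mulmx0.
have -> : row_mx x 0 = row_mx (x 0 0)%:M 0%:M :> 'rV_(1 + 1).
  by rewrite raddf0 -mx11_scalar.
by rewrite qval_binary qval_one expr0n /= !mulr0 !addr0 mul1r.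
Qed.
End CharTwo.

(** * The orthogonal complement of a quasi-Pfister form *)

Section Perp.
Variable F : fieldType.
Hypothesis F2 : 2%N \in [pchar F].
Implicit Types (phi psi chi A B C D : quadForm F).

(** The orthogonal complement of [<<s>><1>] in [<<t>><<s>>[1,be]].  For empty
    [t] the subspace is its own complement; each further slot [d] of [t] adds
    the whole new half [d <<t>><<s>>[1,be]]. *)
Fixpoint qperp s be t : quadForm F :=
  if t is d :: t' then
    qsum (qperp s be t') (qscale d (pfister t' (pfister s (binary 1 1 be))))
  else pfister s (qone F).

Lemma qdim_qperp s be t :
  (qdim (qperp s be t) + 2 ^ size s = 2 ^ (size t + size s).+1)%N.
Proof.
elim: t => [|d t IHt] /=; first by rewrite qdim_pfister muln1 addnn expnS mul2n.
by rewrite !qdim_pfister addnAC IHt mulnA -expnD /= -expnSr addnn addSn [in RHS]expnS mul2n.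
Qed.

Lemma qperp_subform s be t : subform (qperp s be t) (pfister t (pfister s (binary 1 1 be))).
Proof.
elim: t => [|d t IHt] /=; first exact/subform_pfister/subform_one.
by apply: subform_sum IHt _; apply/subform_iso/isometric_refl.
Qed.

Lemma qperp_one s be t : exists x, qval (qmx (qperp s be t)) x = 1.
Proof.
elim: t => [|d t [x x1]] /=.
  elim: s => [|a s [x x1]] /=; first by exists 1%:M; rewrite qval_one mxE expr1n.
  by exists (row_mx x 0); rewrite qval_dbl x1 qval0 mulr0 addr0.
by exists (row_mx x 0); rewrite qval_block x1 qval0 addr0.
Qed.

Lemma polar_pfister_one s : qmx (pfister s (qone F)) + (qmx (pfister s (qone F)))^T = 0.
Proof.
elim: s => [|a s IHs] /=.
  by rewrite trmx1 -mulr2n -scaler_nat pcharf0 // scale0r.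
rewrite tr_block_mx !trmx0 add_block_mx !addr0 IHs linearZ /= -scalerDr IHs scaler0.
exact: block_mx0.
Qed.

Lemma qperp_radical s be t : exists2 R : 'M[F]_(2 ^ size s, qdim (qperp s be t)),
  row_free R & R *m (qmx (qperp s be t) + (qmx (qperp s be t))^T) = 0.
Proof.
elim: t => [|d t [R Rf R0]] /=.
  have e : qdim (pfister s (qone F)) = (2 ^ size s)%N by rewrite qdim_pfister muln1.
  rewrite -e; exists 1%:M; first by rewrite /row_free mxrank1.
  by rewrite polar_pfister_one mulmx0.
exists (row_mx R 0).
  by move/row_freeP: Rf => [Q RQ]; apply/row_freeP; exists (col_mx Q 0);
     rewrite mul_row_col mul0mx addr0.
rewrite tr_block_mx !trmx0 add_block_mx !addr0 mul_row_block R0 !mulmx0 !mul0mx !addr0.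
exact: row_mx0.
Qed.

(** A value [c] of the complement that is not a value of [<<s>><1>] can be made
    a slot: [<<t>><<s>>[1,be] = <<c>><<t'>><<s>>[1,be']].  For [t = d :: t1],
    write [c = c' + d g] along the two halves.  Roundness replaces [d] by
    [d g]; then [c'] is made a slot by induction and merged with [d g] by
    [<<x, y>> = <<x + y, xy>>], unless it is a value of [<<s>><1>].  In that
    case it is a similarity factor of [<<s>>], which reduces to [c' = 1], and
    [qdbl_shift] applies. *)
Lemma qperp_chain s be t x : nonzero s -> nonzero t ->
  qval (qmx (qperp s be t)) x != 0 ->
  (forall y, qval (qmx (pfister s (qone F))) y != qval (qmx (qperp s be t)) x) ->
  exists t' be', [/\ size t = (size t').+1, nonzero t' &
    isometric (pfister t (pfister s (binary 1 1 be)))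
      (qdbl (qval (qmx (qperp s be t)) x) (pfister t' (pfister s (binary 1 1 be'))))].
Proof.
move=> s0; elim: t x => [|d t IHt] x /=; first by move=> _ _ /(_ x) /eqP.
case/andP=> d0 t0; rewrite -[x](@hsubmxK _ 1 (qdim _) (qdim _)).
move: (lsubmx _) (rsubmx _) => {x} x z; rewrite qval_block qval_scale.
set C := pfister t _ in z *; set c' := qval _ x; set g := qval _ z => c0 cS.
have [g0|g0] := eqVneq g 0.
  move: c0 cS; rewrite g0 mulr0 addr0 => c0 cS.
  have [t' [be' [st' t'0 h]]] := IHt x t0 c0 cS.
  exists (d :: t'), be'; split; rewrite /= ?st' ?d0 //.
  exact: isometric_trans (isometric_dbl d h) (qdblC _ _ _).
have simg : simfactor C g.
  have : forall u, qval (qmx C) u != 0 -> simfactor C (qval (qmx C) u).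
    by rewrite /C -pfister_cat => u; apply: pfister_round; rewrite all_cat t0.
  exact.
have hD : isometric (qdbl d C) (qdbl (d * g) C) by apply: qdbl_simfactor.
have D0 : d * g != 0 by rewrite mulf_neq0.
move: (d * g) hD D0 c0 cS => D hD D0 c0 cS.
have [c'0|c'0] := eqVneq c' 0.
  by exists t, be; split=> //; rewrite c'0 add0r.
have [[y yc']|c'S] := pselect (exists y, qval (qmx (pfister s (qone F))) y = c'); last first.
  have [|t' [be' [st' t'0 h]]] := IHt x t0 c'0.
    by move=> y; apply/eqP => yc'; apply: c'S; exists y.
  exists (D * c' :: t'), be'; split; rewrite /= ?st' ?mulf_neq0 //.
  apply: isometric_trans hD _; apply: isometric_trans (isometric_dbl D h) _.
  by rewrite addrC; apply: qdbl_linkage; rewrite addrC.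
have simc' chi : simfactor (pfister s chi) c'.
  by rewrite -yc'; apply: pfister_bilinear_round; rewrite ?yc'.
have Ec : c' + D = (D / c' + 1) * c' by rewrite mulrDl divfK // mul1r addrC.
(* c' is now a value of <<s>><1>: dividing the slot D by c', shifting it by 1 and
   multiplying by c' again turns it into c. *)
have sum0 : D / c' + 1 != 0.
  by apply: contra_neq c0 => h; rewrite Ec h mul0r.
have dvd0 : D / c' != 0 by rewrite mulf_neq0 // invr_eq0.
exists t, (be * (D / c' + 1) / (D / c')); split=> //.
apply: isometric_trans hD _.
apply: isometric_trans (isometric_sym (pfister_dblC _ _ _)) _.
apply: isometric_trans (pfister_dblC _ _ _); apply: isometric_pfister.
apply: isometric_trans (qdbl_simfactor _ (simfactor_inv c'0 (simc' _))) _.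
apply: isometric_trans (isometric_sym (pfister_dblC _ _ _)) _.
apply: isometric_trans (isometric_pfister s (isometric_sym (qdbl_shift F2 _ dvd0 sum0))) _.
apply: isometric_trans (pfister_dblC _ _ _) _.
rewrite Ec.
exact: qdbl_simfactor.
Qed.

(** The hypothesis provides a totally isotropic subspace [D] of
    [(rho + a rho) + (rho + b rho)] of dimension greater than [dim rho].  The
    diagonal [Delta] of the two copies of [rho] is totally isotropic, with
    [Delta^perp / Delta = a rho + b rho].  If this were anisotropic, then the
    intersection of [D] and [Delta^perp] would be [Delta0 = D :&: Delta], and the
    pairing of [D] with [Delta] would have rank at most [dim Delta - dim Delta0],
    so that [dim D <= dim Delta]. *)
Lemma witt_index_dbl rho a b d (X Y : 'M[F]_(d, qdim rho + qdim rho)) :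
  nondeg rho -> (qdim rho < d)%N -> row_free (row_mx X Y) ->
  (forall y : 'rV_d, qval (qmx (qdbl a rho)) (y *m X) = qval (qmx (qdbl b rho)) (y *m Y)) ->
  exists z z', row_mx z z' != 0 /\ a * qval (qmx rho) z = b * qval (qmx rho) z'.
Proof.
move=> nd lt_d free h.
have [//|none] := pselect (exists z z', row_mx z z' != 0 /\
  a * qval (qmx rho) z = b * qval (qmx rho) z').
pose X1 := lsubmx X; pose X2 := rsubmx X; pose Y1 := lsubmx Y; pose Y2 := rsubmx Y.
have val (y : 'rV_d) : qval (qmx rho) (y *m X1) + a * qval (qmx rho) (y *m X2) =
    qval (qmx rho) (y *m Y1) + b * qval (qmx rho) (y *m Y2).
  by have := h y; rewrite -[X]hsubmxK -[Y]hsubmxK !mul_mx_row !qval_dbl.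
pose Z := X1 - Y1; pose K := kermx Z.
have KZ (y : 'rV_d) : (y <= K)%MS -> [/\ y *m X1 = y *m Y1, y *m X2 = 0 & y *m Y2 = 0].
  move/sub_kermxP; rewrite mulmxBr => /eqP; rewrite subr_eq0 => /eqP E1.
  have := val y; rewrite E1 => /addrI E2.
  have /eqP : row_mx (y *m X2) (y *m Y2) = 0.
    apply/eqP/negPn/negP => nz; apply: none.
    by exists (y *m X2), (y *m Y2).
  by rewrite -row_mx0 => /eqP/eq_row_mx[-> ->].
have [KX1 KX2 KY2] : [/\ K *m X1 = K *m Y1, K *m X2 = 0 & K *m Y2 = 0].
  split; apply/row_matrixP => i; have [E1 E2 E3] := KZ _ (row_sub i K);
  by rewrite [LHS]row_mul ?row0 ?[RHS]row_mul.
pose B := qmx rho + (qmx rho)^T.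
have orth : K *m X1 *m B *m Z^T = 0.
  apply/row_matrixP => i; rewrite row0 3!row_mul; apply/rowP => j.
  rewrite [RHS]mxE; set y := row i K.
  have [E1 E2 E3] : [/\ y *m X1 = y *m Y1, y *m X2 = 0 & y *m Y2 = 0].
    by apply: KZ; apply: row_sub.
  pose w : 'rV[F]_d := delta_mx 0 j.
  have pol : pval (qmx rho) (y *m Y1) (w *m X1) = pval (qmx rho) (y *m Y1) (w *m Y1).
    have Ew := val w; have := val (y + w); rewrite !mulmxDl E1 E2 E3 !add0r !qvalD => E.
    apply/eqP; rewrite -subr_eq0; apply/eqP.
    move: E Ew; set l1 := _ + _; set r1 := _ + _; set l2 := _ + _; set r2 := _ + _ => E Ew.
    transitivity (l1 - r1 - (l2 - r2)); first by rewrite /l1 /r1 /l2 /r2; ring.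
    by rewrite E Ew !subrr.
  have : pval (qmx rho) (y *m X1) (w *m Z) = 0.
    by rewrite mulmxBr pvalDr pvalNr E1 pol subrr.
  by rewrite /pval trmx_mul !mulmxA -/B /w trmx_delta -colE mxE.
have rankK : \rank (K *m X1 *m B) = \rank K.
  rewrite mxrankMfree //; apply/eqP; rewrite eqn_leq mxrankM_maxl /=.
  have E : K *m row_mx X Y = K *m X1 *m row_mx (row_mx 1%:M 0) (row_mx 1%:M 0).
    rewrite -[X]hsubmxK -[Y]hsubmxK !mul_mx_row -/X1 -/X2 -/Y1 -/Y2 KX2 KY2 -KX1.
    by rewrite !mulmx1 !mulmx0.
  by rewrite -(mxrankMfree K free) E mxrankM_maxl.
have := mulmx0_rank_max orth; rewrite rankK mxrank_tr /K mxrank_ker.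
by rewrite subnK ?rank_leq_row // leqNgt lt_d.
Qed.

End Perp.

(** * Scalar extension and tensor products *)

Lemma qval_sub_tr (R : comNzRingType) n (U : 'M[R]_n) x : qval (U - U^T) x = 0.
Proof.
rewrite /qval mulmxBr mulmxBl mxE [X in _ + X]mxE.
rewrite [X in _ - X]mx11_tr !trmx_mul !trmxK mulmxA.
by rewrite subrr.
Qed.

Lemma delta_form (R : comNzRingType) n (N : 'M[R]_n) i j :
  ((delta_mx 0 i : 'rV_n) *m N *m (delta_mx 0 j : 'rV_n)^T) 0 0 = N i j.
Proof. by rewrite trmx_delta -rowE -colE !mxE. Qed.

(** An alternating matrix is made of its strictly upper triangular part.  This
    form of the condition survives scalar extension, whereas vanishing at all
    vectors is weak over a finite field. *)
Lemma alternating_split (F : fieldType) n (N : 'M[F]_n) :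
  (forall x, qval N x = 0) -> exists U, N = U - U^T.
Proof.
move=> N0; have Nii i : N i i = 0 by rewrite -delta_form; apply: N0.
have Nij i j : N i j = - N j i.
  apply/eqP; rewrite -addr_eq0; apply/eqP.
  rewrite -(delta_form N i j) -(delta_form N j i) -pvalE.
  by have := N0 (delta_mx 0 i + delta_mx 0 j); rewrite qvalD !N0 !add0r.
exists (\matrix_(i, j) if (i < j)%N then N i j else 0); apply/matrixP => i j.
rewrite !mxE; case: (ltngtP i j) => [lt_ij|lt_ji|/val_inj ->]; rewrite ?subr0 ?sub0r //.
Qed.

(** Isometry as a system of polynomial equations in the entries of [P], its
    inverse [Q], and a matrix [U]. *)
Lemma isometric_altP (F : fieldType) (phi psi : quadForm F) : isometric phi psi <->
  exists P Q U, [/\ P *m Q = 1%:M, Q *m P = 1%:M &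
    P *m qmx psi *m P^T = qmx phi + (U - U^T)].
Proof.
split=> [/isometricP[P [Q [PQ QP h]]]|[P [Q [U [PQ QP h]]]]].
  have [|U EU] := @alternating_split F _ (P *m qmx psi *m P^T - qmx phi).
    move=> x; rewrite /qval mulmxBr mulmxBl [LHS]mxE [X in _ + X]mxE.
    by rewrite !mulmxA -(mulmxA _ P^T) -trmx_mul -/(qval _ (x *m P)) h subrr.
  by exists P, Q, U; rewrite -EU addrC subrK.
apply/isometricP; exists P, Q; split=> // x.
have -> : qval (qmx psi) (x *m P) = qval (P *m qmx psi *m P^T) x.
  by rewrite /qval trmx_mul !mulmxA.
rewrite h /qval mulmxDr mulmxDl [LHS]mxE -!/(qval _ _) (qval_sub_tr U x).
by rewrite addr0.
Qed.

Section Ext.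
Variables (F K : fieldType) (f : {rmorphism F -> K}).
Implicit Types phi psi : quadForm F.

Lemma qext_isometric phi psi : isometric phi psi -> isometric (qext f phi) (qext f psi).
Proof.
case/isometric_altP=> P [Q [U [PQ QP h]]]; apply/isometric_altP.
exists (map_mx f P), (map_mx f Q), (map_mx f U); split.
- by rewrite -map_mxM PQ map_mx1.
- by rewrite -map_mxM QP map_mx1.
by rewrite !map_trmx -!map_mxM h map_mxD map_mxB.
Qed.

Lemma qext_sum phi psi : qext f (qsum phi psi) = qsum (qext f phi) (qext f psi).
Proof. by rewrite /qext /qsum /= map_block_mx !map_mx0. Qed.

Lemma qext_scale c phi : qext f (qscale c phi) = qscale (f c) (qext f phi).
Proof. by rewrite /qext /qscale /= map_mxZ. Qed.

Lemma qext_dbl a phi : qext f (qdbl a phi) = qdbl (f a) (qext f phi).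
Proof. by rewrite /qdbl qext_sum qext_scale. Qed.

Lemma qext_pfister s phi : qext f (pfister s phi) = pfister (map f s) (qext f phi).
Proof. by elim: s => //= a s IHs; rewrite qext_dbl IHs. Qed.

Lemma qext_binary a b c : qext f (binary a b c) = binary (f a) (f b) (f c).
Proof. by rewrite /qext /binary /= map_block_mx map_mx0 !map_scalar_mx. Qed.

Lemma qext_one : qext f (qone F) = qone K.
Proof. by rewrite /qext /qone /= map_mx1. Qed.

Lemma all_neq0_map (s : seq F) : nonzero (map f s) = nonzero s.
Proof. by rewrite all_map; apply: eq_all => a /=; rewrite fmorph_eq0. Qed.
End Ext.

Lemma qext_comp (F K L : fieldType) (f : {rmorphism F -> K}) (g : {rmorphism K -> L}) phi :
  qext (g \o f) phi = qext g (qext f phi).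
Proof. by rewrite /qext /= map_mx_comp. Qed.

Lemma tens_mx11 (R : comNzRingType) m n : (1%:M : 'M[R]_m) *t (1%:M : 'M[R]_n) = 1%:M.
Proof.
apply/matrixP => i j; case/(@mxtens_indexP m n): i => i k; case/(@mxtens_indexP m n): j => j l.
rewrite tensmxE !mxE (can_eq (@mxtens_indexK m n)) xpair_eqE.
by case: (i == j); case: (k == l); rewrite ?mulr1n ?mulr0n ?mulr0 ?mul0r ?mulr1.
Qed.

Section Tensor.
Variable F : fieldType.
Implicit Types (phi psi : quadForm F) (B C : symBilForm F).

Lemma isometric_reindex phi psi (s : 'I_(qdim phi) -> 'I_(qdim psi)) t :
  cancel s t -> cancel t s ->
  (forall i j, qmx psi (s i) (s j) = qmx phi i j) -> isometric phi psi.
Proof.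
move=> st ts h.
apply: (@isometric_mx _ phi psi (rowsub s 1%:M) (rowsub t 1%:M)).
- by rewrite mul_rowsub_mx mul1mx; apply/matrixP => i j; rewrite !mxE st.
- by rewrite mul_rowsub_mx mul1mx; apply/matrixP => i j; rewrite !mxE ts.
rewrite mul_rowsub_mx mul1mx; apply/matrixP => i j.
rewrite -h mxE (bigD1 (s j)) //= big1 ?addr0; last first.
  by move=> k /negPf kj; rewrite !mxE eq_sym kj mulr0.
by rewrite !mxE eqxx mulr1.
Qed.

Lemma qtens_one phi : isometric (qtens (bdiag [:: 1]) phi) phi.
Proof.
apply: isometric_sym.
pose s (i : 'I_(qdim phi)) : 'I_(1 * qdim phi) := mxtens_index (ord0, i).
pose t (i : 'I_(1 * qdim phi)) := (mxtens_unindex i).2.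
apply: (@isometric_reindex phi (qtens (bdiag [:: 1]) phi) s t).
- by move=> i; rewrite /t /s mxtens_indexK.
- move=> i; rewrite /t /s -[RHS](@mxtens_unindexK 1 (qdim phi)).
  by case: (mxtens_unindex _) => k j; rewrite [k]ord1.
by move=> i j; rewrite /= /s tensmxE !mxE eqxx mulr1n mul1r.
Qed.

(** Both forms have the same matrix, up to the bijection of the index sets that
    splits off the index of the first tensor factor. *)
Lemma qtens_dbl a B phi :
  isometric (qtens (btens (bdiag [:: 1; a]) B) phi) (qdbl a (qtens B phi)).
Proof.
apply: isometric_sym; set m := bdim B; set n := qdim phi.
pose s (i : 'I_(m * n + m * n)) : 'I_((2 * m) * n) :=
  match split i with
  | inl j => mxtens_index (mxtens_index (0 : 'I_2, (mxtens_unindex j).1), (mxtens_unindex j).2)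
  | inr j => mxtens_index (mxtens_index (1 : 'I_2, (mxtens_unindex j).1), (mxtens_unindex j).2)
  end.
pose t (i : 'I_((2 * m) * n)) : 'I_(m * n + m * n) :=
  let ki := mxtens_unindex (mxtens_unindex i).1 in
  let x := mxtens_index (ki.2, (mxtens_unindex i).2) in
  if ki.1 == 0 then lshift _ x else rshift _ x.
have sl i j : s (lshift _ (mxtens_index (i, j))) = mxtens_index (mxtens_index (0 : 'I_2, i), j).
  by rewrite /s (unsplitK (inl _)) mxtens_indexK.
have sr i j : s (rshift _ (mxtens_index (i, j))) = mxtens_index (mxtens_index (1 : 'I_2, i), j).
  by rewrite /s (unsplitK (inr _)) mxtens_indexK.
apply: (@isometric_reindex (qdbl a (qtens B phi)) (qtens (btens (bdiag [:: 1; a]) B) phi) s t).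
- move=> i; case: (@split_ordP (m * n) (m * n) i) => k ->; case/(@mxtens_indexP m n): k => k l.
    by rewrite sl /t !mxtens_indexK.
  by rewrite sr /t !mxtens_indexK.
- move=> i; case/(@mxtens_indexP (2 * m) n): i => i j; case/(@mxtens_indexP 2 m): i => k i.
  rewrite /t !mxtens_indexK /=; case: eqP => [->|/eqP k0]; first exact: sl.
  rewrite sr; congr (mxtens_index (mxtens_index (_, _), _)).
  by apply: val_inj; case: k k0 => -[|[]].
have D (k l : 'I_2) : bmx (bdiag [:: 1; a]) k l =
    if k == l then (if k == 0 then 1 else a) else 0.
  by rewrite /= !mxE; case: k l => -[|[]] // k0 [[|[]] // l0]; rewrite ?mulr1n ?mulr0n.
move=> i j.
case: (@split_ordP (m * n) (m * n) i) => k ->; case: (@split_ordP (m * n) (m * n) j) => l ->;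
  case/(@mxtens_indexP m n): k => k k'; case/(@mxtens_indexP m n): l => l l';
  rewrite ?sl ?sr [LHS]tensmxE [X in X * _]tensmxE D /=.
- by rewrite block_mxEul tensmxE mul1r.
- by rewrite block_mxEur !mul0r mxE.
- by rewrite block_mxEdl !mul0r mxE.
by rewrite block_mxEdr mxE tensmxE mulrA.
Qed.

Lemma isometric_tensl B C phi :
  bil_isometric B C -> isometric (qtens B phi) (qtens C phi).
Proof.
case=> P [/row_freeP[Q PQ] /row_fullP[Q' QP'] h].
have QP : Q *m P = 1%:M by rewrite -[Q]mul1mx -QP' -(mulmxA Q') PQ mulmx1 QP'.
have E : P *m bmx C *m P^T = bmx B.
  apply/matrixP => i j; rewrite -[LHS]delta_form -[RHS]delta_form.
  by have := h (delta_mx 0 i) (delta_mx 0 j); rewrite /beval trmx_mul !mulmxA.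
apply: (@isometric_mx F (qtens B phi) (qtens C phi) (P *t 1%:M) (Q *t 1%:M)) => /=.
- by rewrite tensmx_mul PQ mulmx1; apply: tens_mx11.
- by rewrite tensmx_mul QP mulmx1; apply: tens_mx11.
by rewrite trmx_tens trmx1 !tensmx_mul E mul1mx mulmx1.
Qed.

Lemma qtens_bpfister s phi : isometric (qtens (bpfister s) phi) (pfister s phi).
Proof.
elim: s => [|a s IHs]; first exact: qtens_one.
exact: isometric_trans (qtens_dbl _ _ _) (isometric_dbl a IHs).
Qed.
End Tensor.

(** * Cassels-Pfister theorem with linear constraints *)

Section CasselsPfister.
Variables (E : fieldType) (N : nat) (A : 'M[E]_N).
Hypothesis anA : aniso A.
Local Notation "M ^P" := (map_mx (polyC : E -> {poly E}) M) (at level 2, format "M ^P").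

Lemma coefM_top (p q : {poly E}) d : (size p <= d.+1)%N -> (size q <= d.+1)%N ->
  (p * q)`_(d + d) = p`_d * q`_d.
Proof.
move=> sp sq; rewrite coefM.
have dlt : (d < (d + d).+1)%N by rewrite ltnS leq_addr.
rewrite (bigD1 (Ordinal dlt)) //= addnK big1 ?addr0 // => i ni.
have [lt_di|le_id] := ltnP d i.
  by rewrite (nth_default _ (leq_trans sp lt_di)) mul0r.
have lt_id : (i < d)%N by rewrite ltn_neqAle le_id andbT.
rewrite (nth_default _ (leq_trans sq _)) ?mulr0 // ltn_subRL.
by rewrite ltn_add2r.
Qed.

(** Hence the coefficient of degree [2d] does not vanish when [A] is anisotropic
    and [d] is the largest degree of an entry: there is no cancellation. *)
Lemma qval_coef (g : 'rV[{poly E}]_N) d : (forall i, size (g 0%R i) <= d.+1)%N ->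
  (qval A^P g)`_(d + d) = qval A (map_mx (fun p : {poly E} => p`_d) g).
Proof.
move=> sg; rewrite /qval !mxE coef_sum; apply: eq_bigr => j _; rewrite !mxE.
rewrite coefM_top //; first last.
  apply: leq_trans (size_sum _ _ _) _; apply/bigmax_leqP => i _.
  by rewrite !mxE mulrC mul_polyC; apply: leq_trans (size_scale_leq _ _) _.
congr (_ * _); rewrite coef_sum; apply: eq_bigr => i _.
by rewrite !mxE coefMC.
Qed.

Lemma qval_poly_size (g : 'rV[{poly E}]_N) m :
  (size (qval A^P g) <= m + m)%N -> forall i, (size (g 0%R i) <= m)%N.
Proof.
move=> sH; pose n := (\max_i size (g 0%R i))%N.
have: (forall i, size (g 0%R i) <= m + n)%N.
  by move=> i; apply: leq_trans (leq_bigmax i) (leq_addl _ _).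
elim: n => [|n IHn] sg; first by move=> i; rewrite -[m]addn0.
apply: IHn => i; rewrite leqNgt; apply/negP => lt_gi.
have := @qval_coef g (m + n) _; rewrite -addnS => /(_ sg).
rewrite nth_default; last first.
  by apply: leq_trans sH _; rewrite leq_add // leq_addr.
move/esym/anA/matrixP/(_ 0 i); rewrite !mxE => /eqP.
have -> : (m + n)%N = (size (g 0%R i)).-1.
  apply/eqP; rewrite -eqSS prednK ?(leq_ltn_trans _ lt_gi) //.
  by rewrite eqn_leq lt_gi -addnS sg.
by rewrite -lead_coefE lead_coef_eq0 => /eqP g0; rewrite g0 size_poly0 in lt_gi.
Qed.

Lemma aniso_poly : aniso A^P.
Proof.
move=> g g0; apply/rowP => i; apply/eqP; rewrite mxE -size_poly_leq0.
by apply: qval_poly_size; rewrite g0 size_poly0.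
Qed.

(** The classical descent on the degree of the denominator.  If [g / h] is a
    solution, divide [g = h k + w]; the second intersection of the line through
    [g / h] and [k] with the quadric has denominator [h'] of smaller degree.
    The constraints have constant coefficients: the remainder [w] of a solution
    satisfies [w M = 0] for degree reasons, so [k], and with it the whole line,
    satisfies them. *)
Lemma cassels_pfister r (M : 'M[E]_(N, r)) (H : {poly E}) (l : 'rV[{poly E}]_r)
    g (h : {poly E}) :
  h != 0 -> qval A^P g = h ^+ 2 * H -> g *m M^P = h *: l ->
  exists2 g', qval A^P g' = H & g' *m M^P = l.
Proof.
have [n] := ubnP (size h); elim: n g h => // n IHn g h; rewrite ltnS => sh h0 gH gM.
pose k := map_mx (fun p => p %/ h) g; pose w := map_mx (fun p => p %% h) g.
have Dg : g = h *: k + w by apply/rowP => i; rewrite !mxE mulrC -divp_eq.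
have wM : w *m M^P = 0.
  have E1 : w *m M^P = h *: (l - k *m M^P).
    by rewrite scalerBr -gM Dg mulmxDl -scalemxAl addrAC subrr add0r.
  apply/rowP => j; move/rowP/(_ j): (E1); rewrite [RHS]mxE => E2.
  have lt_h : (size ((w *m M^P) 0%R j) < size h)%N.
    rewrite mxE; apply: leq_ltn_trans (size_sum _ _ _) _.
    have sh0 : (0 < size h)%N by rewrite size_poly_gt0.
    rewrite -(prednK sh0) ltnS; apply/bigmax_leqP => i _.
    rewrite !mxE mulrC mul_polyC; apply: leq_trans (size_scale_leq _ _) _.
    by rewrite -ltnS prednK // ltn_modp.
  by rewrite -[LHS](modp_small lt_h) E2 modp_mulr mxE.
have kM : k *m M^P = l.
  move: gM; rewrite Dg mulmxDl wM addr0 -scalemxAl => /matrixP E1.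
  by apply/matrixP => i j; move: (E1 i j); rewrite !mxE => /(mulfI h0).
have [w0|w_n0] := eqVneq w 0.
  exists k => //; move: gH; rewrite Dg w0 addr0 qvalZ.
  by move/mulfI; apply; rewrite expf_neq0.
(* h' is the value of w divided by h: the denominator of the new point. *)
pose h' := h * H - pval A^P k g + h * qval A^P k.
have hh' : qval A^P w = h * h'.
  have -> : w = g - h *: k by rewrite Dg addrC addKr.
  by rewrite qvalB qvalZ gH pvalZr /h' (pvalC _ k); ring.
have h'0 : h' != 0.
  by apply: contra_neq w_n0 => h'0; apply: aniso_poly; rewrite hh' h'0 mulr0.
(* The new point is k + (A(k) - H) w / h', brought to the denominator h'. *)
apply: (IHn (h' *: k + (qval A^P k - H) *: w) h') => //; last first.
- by rewrite mulmxDl -!scalemxAl wM scaler0 addr0 kM.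
- rewrite qvalD !qvalZ pvalZl pvalZr hh'.
  have -> : pval A^P k w = pval A^P k g - h * (2%:R * qval A^P k).
    have -> : w = g - h *: k by rewrite Dg addrC addKr.
    by rewrite pvalDr pvalNr pvalZr pvalxx.
  rewrite /h'; ring.
have: (size (h * h')%R <= (size h).-1 + (size h).-1 - 1)%N.
  rewrite -hh' /qval mxE; apply: leq_trans (size_sum _ _ _) _.
  apply/bigmax_leqP => j _.
  have sw i : (size (w 0%R i) <= (size h).-1)%N.
    by rewrite mxE -ltnS prednK ?size_poly_gt0 // ltn_modp.
  have swA : (size ((w *m A^P) 0%R j) <= (size h).-1)%N.
    rewrite mxE; apply: leq_trans (size_sum _ _ _) _.
    apply/bigmax_leqP => i _; rewrite [A^P _ _]mxE mulrC mul_polyC.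
    exact: leq_trans (size_scale_leq _ _) _.
  apply: leq_trans (size_polyMleq _ _) _; rewrite [w^T _ _]mxE.
  by move: (sw j) swA; move: (size _) (size _) (size _); lia.
rewrite size_mul // => le1.
have sh0 : (0 < size h)%N by rewrite size_poly_gt0.
have sh'0 : (0 < size h')%N by rewrite size_poly_gt0.
apply: leq_trans _ sh.
by move: le1 sh0 sh'0; move: (size h) (size h'); lia.
Qed.
End CasselsPfister.

(** * Generic points *)

Section FractionDenominator.
Local Open Scope quotient_scope.

Lemma frac_denom (R : idomainType) (x : {fraction R}) :
  exists2 d : R, d != 0 & exists n : R, FracField.tofrac d * x = FracField.tofrac n.
Proof.
elim/quotW: x => r; exists \d_r; first exact: denom_ratioP.
exists \n_r; unlock FracField.tofrac; rewrite -[LHS]FracField.pi_mul.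
apply/eqmodP; rewrite /= FracField.equivfE /FracField.mulf.
rewrite !numden_Ratio ?mulf_neq0 ?denom_ratioP ?oner_neq0 //.
by rewrite !mul1r mulr1 mulrC.
Qed.
End FractionDenominator.

Lemma frac_denom_row (R : idomainType) N (u : 'rV[{fraction R}]_N) :
  exists2 d : R, d != 0 &
    exists g : 'rV[R]_N, map_mx (@FracField.tofrac R) g = FracField.tofrac d *: u.
Proof.
have [d dP] := fin_all_exists2 (fun i => frac_denom (u 0 i)).
case/fin_all_exists=> n nP; exists (\prod_i d i).
  by apply/prodf_neq0 => i _; apply: dP.
exists (\row_i (n i * \prod_(j | j != i) d j)); apply/rowP => i.
have Dh : \prod_i d i = d i * \prod_(j | j != i) d j by rewrite (bigD1 i).
by rewrite !mxE Dh !tofracM -nP mulrAC.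
Qed.

Lemma cassels_pfister_frac (E : fieldType) (inj : {rmorphism E -> {fraction {poly E}}})
    (injE : inj =1 fun a => FracField.tofrac a%:P)
    N (A : 'M[E]_N) r (M : 'M[E]_(N, r)) (H : {poly E}) (l : 'rV[{poly E}]_r) u :
  aniso A -> qval (map_mx inj A) u = FracField.tofrac H ->
  u *m map_mx inj M = map_mx (@FracField.tofrac _) l ->
  exists2 g, qval (map_mx polyC A) g = H & g *m map_mx polyC M = l.
Proof.
move=> anA uH uM; have [h h0 [g gE]] := frac_denom_row u.
have mapE m n (B : 'M[E]_(m, n)) :
    map_mx inj B = map_mx (@FracField.tofrac _) (map_mx polyC B).
  by apply/matrixP => i j; rewrite !mxE injE.
have inj_tofrac : injective (@FracField.tofrac {poly E}).
  by move=> p q /eqP; rewrite tofrac_eq => /eqP.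
apply: (@cassels_pfister _ _ _ anA _ _ _ _ g h h0).
  apply: inj_tofrac; rewrite -qval_map gE qvalZ -mapE uH.
  by rewrite rmorphM rmorphXn.
have: map_mx (@FracField.tofrac _) (g *m map_mx polyC M) =
      map_mx (@FracField.tofrac _) (h *: l).
  by rewrite map_mxM gE -mapE -scalemxAl uM map_mxZ.
move/matrixP=> E1; apply/matrixP => i j; apply: inj_tofrac.
by have := E1 i j; rewrite [LHS]mxE [RHS]mxE.
Qed.

(** Stands for a vector [x] of independent indeterminates.  The last clause is
    the representation theorem of Cassels and Pfister, which yields subforms
    from a single generic value; the constraints in it make its proof by
    induction possible, and are also how orthogonality to a vector enters.  The
    third clause is a specialization principle, used in that induction. *)
Definition generic_point (F E : fieldType) (f : {rmorphism F -> E}) d (x : 'rV[E]_d) :=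
  [/\ forall N (A : 'M[F]_N), aniso A -> aniso (map_mx f A),
      (0 < d)%N -> x != 0,
      forall N r (A : 'M[F]_N) (M : 'M[F]_(N, r)) a l, aniso A ->
        (exists2 v, qval (map_mx f A) v = f a & v *m map_mx f M = map_mx f l) ->
        exists2 v, qval A v = a & v *m M = l &
      forall N r (A : 'M[F]_N) (M : 'M[F]_(N, r)) (Q : 'M_d) (L : 'M_(d, r)),
        aniso A ->
        (exists2 u, qval (map_mx f A) u = qval (map_mx f Q) x &
                    u *m map_mx f M = x *m map_mx f L) ->
        exists2 S : 'M_(d, N), forall y, qval A (y *m S) = qval Q y & S *m M = L].

(** The reflection in [v - v'] maps [v] to [v']; here it is applied to [u].
    That the result differs from [u] by a multiple of [v - v'] is what keeps
    linear constraints satisfied by both [v] and [v'] unchanged. *)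
Lemma reflection (E : fieldType) N (A : 'M[E]_N) (u v v' : 'rV[E]_N) :
  aniso A -> qval A v = qval A v' ->
  exists2 c, qval A (u - c *: (v - v')) = qval A u &
             pval A (u - c *: (v - v')) v' = pval A u v.
Proof.
move=> anA vv'; have [->|w0] := eqVneq v v'.
  by exists 0; rewrite scale0r subr0.
have q0 : qval A (v - v') != 0.
  by apply: contra_neq w0 => /anA/eqP; rewrite subr_eq0 => /eqP.
exists (pval A u (v - v') / qval A (v - v')).
  by rewrite qvalB qvalZ pvalZr; field.
have E1 : pval A (v - v') v' = - qval A (v - v').
  by rewrite qvalB pvalDl pvalNl pvalxx vv'; ring.
rewrite pvalDl pvalNl pvalZl E1.
by rewrite mulrN opprK divfK // pvalDr pvalNr; ring.
Qed.

Lemma qval_affine (E : comNzRingType) N (A : 'M[E]_N) (u v : 'rV[E]_N) :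
  qval (map_mx polyC A) (map_mx polyC u + 'X *: map_mx polyC v) =
  (qval A u)%:P + 'X * (pval A u v)%:P + 'X ^+ 2 * (qval A v)%:P.
Proof. by rewrite qvalD qvalZ pvalZr !qval_map pval_map /=; ring. Qed.

Lemma affine_inj (E : comNzRingType) (a b c a' b' c' : E) :
  a%:P + 'X * b%:P + 'X ^+ 2 * c%:P = a'%:P + 'X * b'%:P + 'X ^+ 2 * c'%:P ->
  [/\ a = a', b = b' & c = c'].
Proof.
move=> /polyP h; have := (h 0%N, h 1%N, h 2%N); rewrite !coefD !coefXM !coefXnM !coefC /=.
by rewrite !addr0 !add0r => -[[-> ->] ->].
Qed.

(** Indeterminates are adjoined one at a time; the new one is the first
    coordinate.  By Cassels-Pfister the solution is a polynomial in the new
    indeterminate, of degree at most one since [A] is anisotropic, say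
    [u0 + X v].  The value of [v] is in [F], so some [v0] over [F] has the same
    value, and a reflection moves [v] to [v0].  The remaining vector [u0] is
    orthogonal to [v0] up to a linear form in the old indeterminates, which
    becomes one more constraint for the induction. *)
Lemma generic_point_exists (F : fieldType) d :
  exists (E : fieldType) (f : {rmorphism F -> E}) (x : 'rV[E]_d), generic_point f x.
Proof.
elim: d => [|d [E [f [x [an_f x_n0 spec_f rep_f]]]]].
  exists F, idfun, 0; split=> //.
  - by move=> N A; rewrite map_mx_id.
  - by move=> N r A M a l _ [v]; rewrite !map_mx_id // => *; exists v.
  move=> N r A M Q L _ _; exists 0; last by rewrite [RHS]flatmx0 flatmx0.
  by move=> y; rewrite (thinmx0 y) mul0mx !qval0.
pose inj : {rmorphism E -> {fraction {poly E}}} := @FracField.tofrac _ \o polyC.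
have injE : inj =1 fun a => FracField.tofrac a%:P by [].
pose e0 : 'rV[F]_(1 + d) := row_mx 1 0.
pose J : 'M[F]_(d, 1 + d) := row_mx 0 1%:M.
pose e := map_mx f e0.
pose y : 'rV[E]_(1 + d) := x *m map_mx f J.
pose xP : 'rV[{poly E}]_(1 + d) := map_mx polyC y + 'X *: map_mx polyC e.
exists {fraction {poly E}}, (inj \o f), (map_mx (@FracField.tofrac _) xP).
have mapE m n (B : 'M[F]_(m, n)) :
    map_mx (inj \o f) B = map_mx (@FracField.tofrac _) (map_mx polyC (map_mx f B)).
  by apply/matrixP => i j; rewrite !mxE.
split.
- move=> N A anA z; rewrite mapE => z0.
  have [h h0 [g gE]] := frac_denom_row z.
  have: qval (map_mx polyC (map_mx f A)) g = 0.
    by apply/eqP; rewrite -tofrac_eq0 -qval_map gE qvalZ z0 mulr0.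
  move/(aniso_poly (an_f _ _ anA)) => g0; move: gE; rewrite g0 map_mx0.
  by move/esym/eqP; rewrite scaler_eq0 tofrac_eq0 (negPf h0) => /eqP.
- move=> _; apply/eqP => /rowP/(_ 0); rewrite !mxE => /eqP.
  rewrite tofrac_eq0 => /eqP/(congr1 (fun p : {poly E} => p`_1)).
  rewrite coefD coefXM !coefC /= add0r.
  case: splitP => [j _|j] //=.
  by rewrite ord1 mxE rmorph1 => /eqP; rewrite oner_eq0.
- move=> N r A M a l anA [v va vM].
  apply: spec_f => //.
  have [|||g gA gM] := @cassels_pfister_frac _ _ injE _ (map_mx f A) _ (map_mx f M)
    (f a)%:P (map_mx polyC (map_mx f l)) v; first exact: an_f.
  + by rewrite -map_mx_comp va.
  + by rewrite -map_mx_comp vM mapE.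
  have ev0 m n (B : 'M[E]_(m, n)) : map_mx (horner_eval 0) (map_mx polyC B) = B.
    by apply/matrixP => i j; rewrite !mxE /horner_eval hornerC.
  exists (map_mx (horner_eval 0) g).
    by rewrite -(ev0 _ _ (map_mx f A)) qval_map gA /= /horner_eval hornerC.
  by rewrite -(ev0 _ _ (map_mx f M)) -map_mxM gM ev0.
move=> N r A M Q L anA [u uA uM].
pose Af := map_mx f A; pose Qf := map_mx f Q.
have anAf : aniso Af by apply: an_f.
have [||g gA gM] := @cassels_pfister_frac _ _ injE _ Af _ (map_mx f M)
    (qval (map_mx polyC Qf) xP) (xP *m map_mx polyC (map_mx f L)) u anAf.
- by rewrite -map_mx_comp uA mapE qval_map.
- by rewrite -map_mx_comp uM mapE map_mxM.
have sg : forall i, (size (g 0%R i) <= 2)%N.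
  apply: (qval_poly_size anAf); rewrite gA qval_affine.
  have sC (c : E) k : (size (('X : {poly E}) ^+ k * c%:P)%R <= k.+1)%N.
    apply: leq_trans (size_polyMleq _ _) _.
    by rewrite size_polyXn; have := size_polyC_leq1 c; case: (size _) => [|[|]]; lia.
  apply: leq_trans (size_polyD _ _) _; rewrite geq_max (leq_trans (sC _ _)) // andbT.
  apply: leq_trans (size_polyD _ _) _; rewrite geq_max.
  rewrite (leq_trans (size_polyC_leq1 _)) //.
  by rewrite (leq_trans (sC _ 1%N)).
pose u0 := map_mx (fun p : {poly E} => p`_0) g.
pose v := map_mx (fun p : {poly E} => p`_1) g.
have gE : g = map_mx polyC u0 + 'X *: map_mx polyC v.
  apply/rowP => i; rewrite !mxE; apply/polyP => -[|[|k]].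
  + by rewrite coefD coefXM coefC /= addr0.
  + by rewrite coefD coefXM !coefC /= add0r.
  rewrite coefD coefXM !coefC /= addr0.
  by rewrite nth_default // (leq_trans (sg i)).
move: gA; rewrite gE !qval_affine => /affine_inj[Eu0 Eb Ev].
have [Mu0 Mv] : u0 *m map_mx f M = y *m map_mx f L /\ v *m map_mx f M = e *m map_mx f L.
  move: gM; rewrite gE !mulmxDl -!scalemxAl -!map_mxM => /matrixP gM.
  split; apply/matrixP => i j; move/polyP: (gM i j).
    by move/(_ 0%N); rewrite !mxE !coefD !coefXM !coefC /= !addr0.
  by move/(_ 1%N); rewrite !mxE !coefD !coefXM !coefC /= !add0r.
have [|v0 v0A v0M] := spec_f _ _ A M (qval Q e0) (e0 *m L) anA.
  exists v; first by rewrite Ev qval_map.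
  by rewrite Mv map_mxM.
have [|c refl_q refl_b] := @reflection _ _ Af u0 v (map_mx f v0) anAf.
  by rewrite Ev !qval_map v0A.
set u' := u0 - _ in refl_q refl_b.
(* The last column of the constraints prescribes the polar pairing with v0. *)
have [|S SQ SM] := rep_f _ _ A (row_mx M ((A + A^T) *m v0^T)) (J *m Q *m J^T)
    (row_mx (J *m L) (J *m (Q + Q^T) *m e0^T)) anA.
  exists u'.
    by rewrite refl_q Eu0 /qval /y !map_mxM -map_trmx trmx_mul !mulmxA.
  rewrite !map_row_mx !mul_mx_row; congr row_mx.
    have Ev0 : map_mx f v0 *m map_mx f M = e *m map_mx f L.
      by rewrite -map_mxM v0M map_mxM.
    rewrite /u' mulmxBl -scalemxAl mulmxBl Mu0 Mv Ev0 subrr scaler0 subr0.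
    by rewrite map_mxM mulmxA.
  apply/matrixP => i j; rewrite !ord1.
  rewrite !map_mxM !map_mxD -!map_trmx !mulmxA.
  by move: refl_b; rewrite Eb /pval /y.
have zJ z : qval (J *m Q *m J^T) z = qval Q (z *m J).
  by rewrite /qval trmx_mul !mulmxA.
move: SM; rewrite mul_mx_row => /eq_row_mx[SM Sb].
exists (col_mx v0 S).
  move=> w; pose a := lsubmx (w : 'rV_(1 + d)); pose z := rsubmx (w : 'rV_(1 + d)).
  have -> : w = a 0 0 *: e0 + z *m J.
    transitivity (row_mx a z); first exact: esym (@hsubmxK _ 1 1 d w).
    rewrite mul_mx_row mulmx0 mulmx1 scale_row_mx scaler0 add_row_mx addr0 add0r.
    by rewrite scalemx1 -mx11_scalar.
  rewrite mulmxDl -scalemxAl.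
  have -> : e0 *m col_mx v0 S = v0 by rewrite mul_row_col mul1mx mul0mx addr0.
  have -> : z *m J *m col_mx v0 S = z *m S.
    by rewrite -mulmxA mul_row_col mul0mx mul1mx add0r.
  rewrite !qvalD !qvalZ v0A SQ zJ !pvalZl; congr (_ + _ * _).
  rewrite pvalC (pvalC Q) /pval -!mulmxA [S *m _]mulmxA.
  by rewrite -(mulmxA S) Sb !mulmxA.
transitivity (col_mx (v0 *m M) (S *m M)); first exact: (@mul_col_mx _ 1 d _ _ v0 S M).
rewrite v0M SM; transitivity (col_mx e0 J *m L).
  by exact: (esym (@mul_col_mx _ 1 d _ _ e0 J L)).
suff -> : col_mx e0 J = 1%:M by rewrite mul1mx.
exact: (esym (@scalar_mx_block F 1 d 1)).
Qed.

(** * Adjoining a square root *)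

(** In the basis [1], [y] of the extension, an isotropic vector [u + y v] has
    [A(u) + t A(v) = 0] and [u] orthogonal to [v].  When [t] is already a square,
    the field need not change. *)
Lemma sqrt_extension (E : fieldType) (char2 : 2%N \in [pchar E]) (t : E) :
  exists (K : fieldType) (g : {rmorphism E -> K}) (y : K), y ^+ 2 = g t /\
    forall N (A : 'M[E]_N), aniso A -> aniso (map_mx g A) \/
      exists u v, [/\ v != 0, qval A u = t * qval A v & pval A u v = 0].
Proof.
have [[y yt]|no_root] := boolp.pselect (exists y, y ^+ 2 = t).
  exists E, idfun, y; split=> // N A anA; left.
  by rewrite map_mx_id.
pose p : {poly E} := 'X^2 - t%:P.
have sp : size p = 3 by rewrite size_XnsubC.
have irr_p : irreducible_poly p.
  apply: cubic_irreducible; rewrite ?sp // => x; apply/negP => /rootP.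
  rewrite !hornerE => /eqP; rewrite subr_eq0 => /eqP xt.
  by apply: no_root; exists x.
have [L _ [z rz genL]] := irredp_FAdjoin irr_p.
pose g : {rmorphism E -> L} := in_alg L.
have zt : z ^+ 2 = g t.
  move/rootP: rz; rewrite rmorphB /= map_polyXn map_polyC !hornerE => /eqP.
  by rewrite subr_eq0 => /eqP.
exists L, g, z; split=> // N A anA; have [anL|not_an] := boolp.pselect (aniso (map_mx g A)).
  by left.
right; have gen w : exists a b, w = g a + z * g b.
  have : w \in <<1; z>>%VS by rewrite genL memvf.
  case/Fadjoin_polyP=> q /polyOver1P[q0 ->] ->.
  have sr : (size (q0 %% p)%R <= 2)%N.
    by rewrite -ltnS -[X in (_ < X)%N]sp ltn_modp -size_poly_gt0 sp.
  have Dr : q0 %% p = ((q0 %% p)`_0)%:P + 'X * ((q0 %% p)`_1)%:P.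
    apply/polyP => -[|[|k]]; rewrite coefD coefXM !coefC /= ?addr0 ?add0r //.
    by rewrite nth_default // (leq_trans sr).
  move: Dr; move: (_`_0) (_`_1) => a b Dr; exists a, b.
  rewrite (divp_eq q0 p) Dr rmorphD rmorphM /= !hornerE (rootP rz) mulr0 add0r.
  by rewrite rmorphD rmorphM /= !map_polyC map_polyX !hornerE.
have indep a b : g a + z * g b = 0 -> a = 0 /\ b = 0.
  have [->|b0 /eqP] := eqVneq b 0.
    by rewrite rmorph0 mulr0 addr0 => /eqP; rewrite fmorph_eq0 => /eqP.
  rewrite addr_eq0 eq_sym eqr_oppLR => /eqP zb; case: no_root.
  exists (a / b); apply: (fmorph_inj g); rewrite -zt rmorphXn fmorph_div.
  have gb : g b != 0 by rewrite fmorph_eq0.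
  have -> : z = - (g a / g b) by rewrite -mulNr -zb mulfK.
  by rewrite sqrrN.
have [x x0] : exists x : 'rV[L]_N, qval (map_mx g A) x = 0 /\ x != 0.
  have [//|none] := boolp.pselect (exists x : 'rV[L]_N, qval (map_mx g A) x = 0 /\ x != 0).
  case: not_an => x qx; apply/eqP/negPn/negP => x_n0; apply: none.
  by exists x.
have [u] := fin_all_exists (fun i => gen (x 0 i)); case/fin_all_exists=> v uv.
have Dx : x = map_mx g (\row_i u i) + z *: map_mx g (\row_i v i).
  by apply/rowP => i; rewrite !mxE uv.
case: x0; rewrite {1}Dx qvalD qvalZ pvalZr !qval_map pval_map zt.
rewrite -rmorphM -rmorphD => /indep[qu buv].
move=> x_n0; exists (\row_i u i), (\row_i v i); split=> //; last first.
  by move/eqP: qu; rewrite addr_eq0 oppr_pchar2 // => /eqP.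
apply: contra_neq x_n0 => v0; move: qu; rewrite v0 qval0 mulr0 addr0 => /anA u0.
by rewrite Dx u0 v0 !map_mx0 scaler0 addr0.
Qed.

(** * Generic zeros and anisotropy *)

Definition qpfister (F : fieldType) s (be : F) := pfister s (binary 1 1 be).

Lemma qext_qpfister (F K : fieldType) (f : {rmorphism F -> K}) s be :
  qext f (qpfister s be) = qpfister (map f s) (f be).
Proof. by rewrite /qpfister qext_pfister qext_binary rmorph1. Qed.

Lemma qext_qperp (F K : fieldType) (f : {rmorphism F -> K}) s be t :
  qext f (qperp s be t) = qperp (map f s) (f be) (map f t).
Proof.
elim: t => [|d t IHt] /=; first by rewrite qext_pfister qext_one.
by rewrite qext_sum IHt qext_scale !qext_pfister qext_binary rmorph1.
Qed.

Lemma qpfister_one (F : fieldType) s (be : F) : exists e, qval (qmx (qpfister s be)) e = 1.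
Proof.
have [P _ h] := subform_pfister s (subform_one be).
have [x x1] := qperp_one s be [::].
by exists (x *m P); rewrite h.
Qed.

Section Descent.
Variables (F : fieldType).
Hypothesis F2 : 2%N \in [pchar F].

Lemma pchar_ext (K : fieldType) (f : {rmorphism F -> K}) : 2%N \in [pchar K].
Proof. exact: (rmorph_pchar f). Qed.

(** The alternative left by [sqrt_extension] for [t = c q(x)].  A similitude
    makes the value of [v] equal to 1, a reflection then moves [v] to [e], and
    the resulting representation of [c q(x)] by a vector orthogonal to [e] is
    made linear by the properties of a generic point. *)
Lemma generic_descent (E : fieldType) (f : {rmorphism F -> E}) s be (q : quadForm F)
    (x : 'rV[E]_(qdim q)) c (e : 'rV_(qdim (qpfister s be))) u v :
  nonzero s -> generic_point f x -> aniso (qmx (qpfister s be)) ->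
  qval (qmx (qpfister s be)) e = 1 ->
  v != 0 -> qval (map_mx f (qmx (qpfister s be))) u =
            f c * qval (map_mx f (qmx q)) x * qval (map_mx f (qmx (qpfister s be))) v ->
  pval (map_mx f (qmx (qpfister s be))) u v = 0 ->
  exists2 S, forall y, qval (qmx (qpfister s be)) (y *m S) = c * qval (qmx q) y &
             forall y : 'rV_(qdim q), pval (qmx (qpfister s be)) e (y *m S) = 0.
Proof.
move=> s0 [an_f _ _ rep_f] an e1 v0 Eu Euv.
set A := qmx _ in an e1 Eu Euv *.
have anE := an_f _ _ an.
have lam0 : qval (map_mx f A) v != 0 by apply: contra_neq v0; apply: anE.
have [P [_ [_ _ hP]]] : exists P Q, [/\ P *m Q = 1%:M, Q *m P = 1%:M &
    forall z, qval (map_mx f A) v * qval (map_mx f A) (z *m P) = qval (map_mx f A) z].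
  have rE : forall v, qval (qmx (qext f (qpfister s be))) v != 0 ->
      simfactor (qext f (qpfister s be)) (qval (qmx (qext f (qpfister s be))) v).
    by rewrite qext_qpfister => w; apply: pfister_round; rewrite ?pchar_ext ?all_neq0_map.
  have /isometricP[P [Q [PQ QP h]]] := rE v lam0.
  by exists P, Q; split=> // z; have := h z; rewrite /= qval_scale; apply.
set l := qval _ v in Eu lam0 hP.
have v'1 : qval (map_mx f A) (v *m P) = 1 by apply: (mulfI lam0); rewrite hP mulr1.
have u't : qval (map_mx f A) (u *m P) = f c * qval (map_mx f (qmx q)) x.
  by apply: (mulfI lam0); rewrite hP Eu mulrC.
have u'v' : pval (map_mx f A) (u *m P) (v *m P) = 0.
  apply: (mulfI lam0); rewrite mulr0 -[RHS]Euv.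
  by rewrite pval_qval -mulmxDl [RHS]pval_qval !mulrBr !hP.
have [|k k1 k2] := @reflection _ _ (map_mx f A) (u *m P) (v *m P) (map_mx f e) anE.
  by rewrite v'1 qval_map e1 rmorph1.
have [|S SQ SM] := rep_f _ _ A ((A + A^T) *m e^T) (c *: qmx q) 0 an.
  exists (u *m P - k *: (v *m P - map_mx f e)).
    by rewrite k1 u't map_mxZ qval_scale.
  rewrite map_mx0 mulmx0 map_mxM map_mxD -!map_trmx.
  apply/matrixP => i j; rewrite !ord1 [RHS]mxE -u'v' -k2.
  by rewrite /pval mulmxA.
exists S; first by move=> y; rewrite SQ qval_scale.
by move=> y; rewrite pvalC /pval -mulmxA -(mulmxA y) SM mulmx0 mxE.
Qed.

(** A form [q] contained in both [<<a>> rho] and [<<b>> rho], of dimension greater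
    than that of [rho], gives a totally isotropic subspace of their sum to which
    [witt_index_dbl] applies.  The factor [c] is removed by a similitude. *)
Lemma shared_subform_isotropic (rho q : quadForm F) a b c (S : 'M_(qdim q, _)) :
  nondeg rho -> (qdim rho < qdim q)%N -> a != 0 -> c != 0 ->
  (forall x, qval (qmx (qdbl a rho)) x != 0 ->
    simfactor (qdbl a rho) (qval (qmx (qdbl a rho)) x)) ->
  (exists x, qval (qmx q) x = 1) ->
  subform q (qdbl b rho) ->
  (forall y, qval (qmx (qdbl a rho)) (y *m S) = c * qval (qmx q) y) ->
  ~ aniso (qmx (qdbl (a * b) rho)).
Proof.
move=> nd dlt a0 c0 rnd [x x1] [I Ifree hI] hS an.
have simc : simfactor (qdbl a rho) c.
  by have := rnd (x *m S); rewrite hS x1 mulr1; apply.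
have /isometricP[P [_ [_ _ hP]]] := simc.
have [|y|z [z' [nz E]]] := @witt_index_dbl _ rho a b _ (S *m P) I nd dlt.
- have /row_freeP[J IJ] := Ifree; apply/row_freeP; exists (col_mx 0 J).
  by rewrite mul_row_col mulmx0 add0r.
- rewrite hI mulmxA; apply: (mulfI c0).
  by rewrite -qval_scale hP hS.
have := an (row_mx (a *: z) z'); rewrite qval_dbl qvalZ => an0.
have /eqP : row_mx (a *: z) z' = 0.
  apply: an0; apply: (eq_mod2 F2 (z := a * b * qval (qmx rho) z')).
  by rewrite subr0 expr2 -(mulrA a a) E; ring.
rewrite -row_mx0 => /eqP/eq_row_mx[az z'0].
case/eqP: nz; rewrite z'0; move/eqP: az; rewrite scaler_eq0 (negPf a0) => /eqP ->.
exact: row_mx0.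
Qed.

(** If [q] does not represent [c], the embedding of [c q] together with [e] is
    injective.  Then [e] and the image of the radical of [q] span a space of
    dimension [k + 1] orthogonal to the image of [q], which has codimension [k];
    this contradicts nondegeneracy. *)
Lemma embedding_represents (psi q : quadForm F) k c (S : 'M_(qdim q, qdim psi)) e :
  nondeg psi -> (qdim q + k = qdim psi)%N -> c != 0 -> simfactor psi c ->
  aniso (qmx q) -> qval (qmx psi) e = 1 ->
  (exists2 R : 'M_(k, qdim q), row_free R & R *m (qmx q + (qmx q)^T) = 0) ->
  (forall y, qval (qmx psi) (y *m S) = c * qval (qmx q) y) ->
  (forall y, pval (qmx psi) e (y *m S) = 0) ->
  exists y, qval (qmx q) y = c.
Proof.
move=> nd dimE c0 simc an e1 [R Rfree R0] hS eS.
have [//|none] := pselect (exists y, qval (qmx q) y = c).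
have Sfree : row_free S.
  rewrite -kermx_eq0; apply/rowV0P => y /sub_kermxP yS; apply: an.
  by apply: (mulfI c0); rewrite -hS yS qval0 mulr0.
have bS y y' : pval (qmx psi) (y *m S) (y' *m S) = c * pval (qmx q) y y'.
  by rewrite !pval_qval -mulmxDl !hS; ring.
pose B := qmx psi + (qmx psi)^T.
pose C : 'M_(1 + k, qdim psi) := col_mx e (R *m S).
have Cfree : row_free C.
  rewrite -kermx_eq0; apply/rowV0P => y /sub_kermxP.
  rewrite -[y](@hsubmxK _ 1 1 k); move: (lsubmx _) (rsubmx _) => {y} l y.
  rewrite mul_row_col mulmxA [l]mx11_scalar mul_scalar_mx; move: (l 0 0) => {}l E.
  have Eq : l ^+ 2 + c * qval (qmx q) (y *m R) = 0.
    have := congr1 (qval (qmx psi)) E.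
    by rewrite qvalD qvalZ pvalZl eS hS e1 qval0 mulr0 mulr1 addr0.
  have l0 : l = 0.
    apply/eqP/negPn/negP => l0; apply: none; exists ((c / l) *: (y *m R)).
    rewrite qvalZ; apply: (mulfI (expf_neq0 2 l0)).
    apply: (eq_mod2 F2 (z := - c * l ^+ 2)).
    transitivity (c * (l ^+ 2 + c * qval (qmx q) (y *m R)) - 2%:R * c * l ^+ 2).
      by field.
    by rewrite Eq; ring.
  move: Eq; rewrite l0 expr0n /= add0r => /eqP.
  rewrite mulf_eq0 (negPf c0) /= => /eqP/an yR.
  rewrite raddf0 (_ : y = 0) ?row_mx0 //.
  by apply: (row_free_inj Rfree); rewrite mul0mx.
have orth : C *m B *m S^T = 0.
  rewrite !mul_col_mx; apply/eqP; rewrite -col_mx0; apply/eqP; congr col_mx.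
    apply/rowP => j; rewrite [RHS]mxE; have := eS (delta_mx 0 j); rewrite /pval -/B => <-.
    by rewrite trmx_mul trmx_delta mulmxA -colE [RHS]mxE.
  apply/matrixP => i j; rewrite [RHS]mxE.
  have E0 : pval (qmx q) (row i R) (delta_mx 0 j) = 0.
    by rewrite /pval -row_mul R0 row0 mul0mx mxE.
  have := bS (row i R) (delta_mx 0 j); rewrite E0 mulr0.
  rewrite /pval -/B trmx_mul trmx_delta mulmxA -colE mxE => <-.
  by rewrite -!row_mul [RHS]mxE.
have := mulmx0_rank_max orth; rewrite mxrankMfree // mxrank_tr.
move/eqP: Cfree => ->; move/eqP: Sfree => ->.
by rewrite -dimE addnC addnA addn1 ltnn.
Qed.
End Descent.

(** * Making one bilinear Pfister form a factor *)

(** Over an extension, this is equivalent to [phi] and [psi] being non-hyperbolic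
    and non-isometric, and it is visibly preserved by ultraproducts. *)
Definition aniso_triple (F : fieldType) r (ga a b : F) :=
  [/\ aniso (qmx (qpfister (a :: r) ga)), aniso (qmx (qpfister (b :: r) ga)) &
      aniso (qmx (qpfister (a * b :: r) ga))].

Lemma aniso_triple_sym (F : fieldType) r (ga a b : F) :
  aniso_triple r ga a b -> aniso_triple r ga b a.
Proof. by case=> h1 h2 h3; split; rewrite // mulrC. Qed.

Lemma aniso_sqr (F : fieldType) a b (rho : quadForm F) : b != 0 ->
  aniso (qmx (qdbl a rho)) -> aniso (qmx (qdbl (a * b ^+ 2) rho)).
Proof.
move=> b0; apply: isometric_aniso.
by apply/isometric_sym/qdbl_simfactor/simfactor_sqr.
Qed.

Lemma qdim_qpfister (F : fieldType) s (be : F) : qdim (qpfister s be) = (2 ^ (size s).+1)%N.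
Proof. by rewrite /qpfister qdim_pfister /= expnSr. Qed.

(** The extension of [F] by a generic zero of [c y^2 + q].  The dimension of [q]
    keeps [phi] and [omega] anisotropic; [psi] stays anisotropic because [q] does
    not represent [c] over [F]. *)
Lemma generic_value_extension (F : fieldType) (F2 : 2%N \in [pchar F]) r
    (ga a b : F) s t be c :
  a != 0 -> b != 0 -> nonzero r -> nonzero s -> nonzero t ->
  (0 < size t)%N -> (size t + size s = (size r).+1)%N -> aniso_triple r ga a b ->
  isometric (qpfister (b :: r) ga) (pfister t (qpfister s be)) ->
  c != 0 -> (forall y, qval (qmx (qperp s be t)) y <> c) ->
  exists (K : fieldType) (h : {rmorphism F -> K}),
    aniso_triple (map h r) (h ga) (h a) (h b) /\
    exists z, qval (qmx (qext h (qperp s be t))) z = h c.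
Proof.
move=> a0 b0 r0 s0 t0 tpos st [ga1 ga2 ga3] psiE c0 not_c.
set q := qperp s be t in not_c *.
have q_sub : subform q (qpfister (b :: r) ga).
  exact: subform_trans (qperp_subform s be t) (subform_iso (isometric_sym psiE)).
have an_q : aniso (qmx q) by apply: subform_aniso q_sub ga2.
have dim_q : (qdim q + 2 ^ size s = 2 ^ (size r).+2)%N by rewrite qdim_qperp st.
have dim_rho : (qdim (qpfister r ga) < qdim q)%N.
  rewrite qdim_qpfister -(ltn_add2r (2 ^ size s)) dim_q [X in (_ < X)%N]expnS mul2n -addnn.
  by rewrite ltn_add2l ltn_exp2l //; move: tpos st; lia.
have q_one := qperp_one s be t; rewrite -/q in q_one.
have nd_rho : nondeg (qpfister r ga) by apply: nondeg_pfister => //; apply: nondeg_binary.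
have [E [f [x gen]]] := generic_point_exists F (qdim q).
have [an_f x_neq0 _ _] := gen.
have x0 : x != 0 by apply: x_neq0; apply: leq_ltn_trans dim_rho.
have qx0 : qval (map_mx f (qmx q)) x != 0 by apply: contra_neq x0; apply: an_f.
have E2 := pchar_ext F2 f.
have [K [g [y [yt alt]]]] := sqrt_extension E2 (f c * qval (map_mx f (qmx q)) x).
have y0 : y != 0.
  by rewrite -sqrf_eq0 yt fmorph_eq0 mulf_neq0 // fmorph_eq0.
pose h : {rmorphism F -> K} := g \o f.
have preserve_aniso d : d != 0 -> aniso (qmx (qpfister (d :: r) ga)) ->
   (forall e S, qval (qmx (qpfister (d :: r) ga)) e = 1 ->
      (forall z, qval (qmx (qpfister (d :: r) ga)) (z *m S) = c * qval (qmx q) z) ->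
      (forall z : 'rV_(qdim q), pval (qmx (qpfister (d :: r) ga)) e (z *m S) = 0) -> False) ->
   aniso (qmx (qpfister (h d :: map h r) (h ga))).
  move=> d0 an noS.
  suff : aniso (qmx (qext h (qpfister (d :: r) ga))) by rewrite qext_qpfister.
  have [|[u [v [v0 Eu Ev]]]] := alt _ _ (an_f _ _ an); first by rewrite -map_mx_comp.
  have [e e1] := qpfister_one (d :: r) ga.
  have dr0 : nonzero (d :: r) by rewrite /= d0.
  by have [S hS eS] := generic_descent dr0 gen an e1 v0 Eu Ev; case: (noS e S).
have rnd d : d != 0 -> forall x, qval (qmx (qdbl d (qpfister r ga))) x != 0 ->
    simfactor (qdbl d (qpfister r ga)) (qval (qmx (qdbl d (qpfister r ga))) x).
  by move=> d0 z; apply: (@pfister_round _ (d :: r)); rewrite /= d0.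
exists K, h; split; last first.
  (* From y^2 = c q(x) one gets q((c / y) x) = c. *)
  exists ((h c / y) *: map_mx g x).
  have -> : qmx (qext h q) = map_mx g (map_mx f (qmx q)) by rewrite -map_mx_comp.
  rewrite qvalZ qval_map; have hc0 : h c != 0 by rewrite fmorph_eq0.
  apply: (mulfI hc0); have := yt; rewrite rmorphM /= => yt'.
  have -> : h c * ((h c / y) ^+ 2 * g (qval (map_mx f (qmx q)) x)) =
     (h c / y) ^+ 2 * (g (f c) * g (qval (map_mx f (qmx q)) x)) by rewrite /h /=; ring.
  by rewrite -yt'; field.
split.
- apply: preserve_aniso => // e S e1 hS _.
  exact: (shared_subform_isotropic F2 nd_rho dim_rho a0 c0 (rnd a a0) q_one q_sub hS) ga3.
- apply: preserve_aniso => // e S e1 hS eS.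
  have [z zc] : exists z, qval (qmx q) z = c.
    apply: (embedding_represents F2 (psi := qpfister (b :: r) ga)
      (k := 2 ^ size s) _ _ c0 _ an_q e1 _ hS eS).
    + by apply: nondeg_pfister; rewrite /= ?b0 //; apply: nondeg_binary.
    + by rewrite dim_q qdim_qpfister.
    + have [w w1] := q_one; have := rnd b b0 (w *m S); rewrite hS w1 mulr1.
      exact.
    exact: qperp_radical.
  exact: not_c zc.
rewrite -rmorphM; apply: preserve_aniso; rewrite ?mulf_neq0 // => e S e1 hS _.
apply: (shared_subform_isotropic F2 nd_rho dim_rho _ c0 (rnd (a * b) _) q_one q_sub hS);
  rewrite ?mulf_neq0 //.
by rewrite -mulrA -expr2; apply: aniso_sqr.
Qed.

(** The cofactor is an (m + 1)-fold quadratic Pfister form: [m] counts its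
    bilinear slots. *)
Definition factor_of (F : fieldType) (psi : quadForm F) s m :=
  exists t be, [/\ size t = m, nonzero t & isometric psi (pfister s (qpfister t be))].

Lemma qext_id (F : fieldType) (phi : quadForm F) : qext idfun phi = phi.
Proof. by case: phi => n A; rewrite /qext /= map_mx_id. Qed.

Lemma factor_ext (F K : fieldType) (h : {rmorphism F -> K}) psi s m :
  factor_of psi s m -> factor_of (qext h psi) (map h s) m.
Proof.
move=> [t [be [<- t0 /(qext_isometric h)]]].
rewrite qext_pfister qext_qpfister => psiE; exists (map h t), (h be).
by split; rewrite ?size_map ?all_neq0_map.
Qed.

Lemma factor_extension_step (F : fieldType) (F2 : 2%N \in [pchar F]) r (ga a b : F) s c m :
  a != 0 -> b != 0 -> nonzero r -> nonzero s -> c != 0 ->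
  (m + size s = size r)%N -> aniso_triple r ga a b ->
  factor_of (qpfister (a :: r) ga) (c :: s) m ->
  factor_of (qpfister (b :: r) ga) s m.+1 ->
  exists (K : fieldType) (h : {rmorphism F -> K}),
    aniso_triple (map h r) (h ga) (h a) (h b) /\
    factor_of (qext h (qpfister (b :: r) ga)) (map h (c :: s)) m.
Proof.
move=> a0 b0 r0 s0 c0 st gd fa [t [be [tm t0 psiE]]].
have psiE' := isometric_trans psiE (pfisterC _ _ _).
have [K [h [gdK [z zc]]]] : exists (K : fieldType) (h : {rmorphism F -> K}),
    aniso_triple (map h r) (h ga) (h a) (h b) /\
    exists z, qval (qmx (qext h (qperp s be t))) z = h c.
  have [[z zc]|none] := pselect (exists z, qval (qmx (qperp s be t)) z = c).
    exists F, idfun; rewrite map_id qext_id; split=> //.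
    by exists z.
  apply: generic_value_extension => //; rewrite ?tm ?addSn ?st //.
  by move=> y yc; apply: none; exists y.
exists K, h; split=> //.
have K2 := pchar_ext F2 h.
have hc0 : h c != 0 by rewrite fmorph_eq0.
have [an_a _ _] := gdK.
move: (qperp _ _ _) (qext_qperp h s be t) z zc => q; rewrite {1 2}/qext /= => qE z zc.
have : exists z, qval (qmx (qperp (map h s) (h be) (map h t))) z = h c.
  by rewrite -qE; exists z.
case=> {}z {}zc {q qE}.
(* A vector y of <<s>><1> with value c would make <<c, s>><1>, which lies in phi,
   isotropic: add to it a vector of value 1 in the second half. *)
have cS y : qval (qmx (pfister (map h s) (qone K))) y !=
    qval (qmx (qperp (map h s) (h be) (map h t))) z.
  rewrite zc; apply/eqP => yc.
  have [t' [be' [_ _ phiE]]] := factor_ext h fa.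
  have [e e1] := qpfister_one t' be'.
  have one_sub : subform (qone K) (qpfister t' be').
    exists (e : 'M_(1, _)).
      rewrite -kermx_eq0; apply/rowV0P => l /sub_kermxP.
      rewrite [l]mx11_scalar mul_scalar_mx => /(congr1 (qval (qmx (qpfister t' be')))).
      rewrite qvalZ e1 qval0 mulr1 => /eqP; rewrite sqrf_eq0 => /eqP ->.
      by rewrite raddf0.
    move=> l; rewrite {1}[l]mx11_scalar mul_scalar_mx qvalZ e1 mulr1.
    by rewrite qval_one.
  have an_S : aniso (qmx (pfister (map h (c :: s)) (qone K))).
    apply: subform_aniso (subform_pfister _ one_sub) _.
    apply: isometric_aniso (isometric_sym phiE) _.
    by rewrite qext_qpfister.
  have [y1 y11] := qperp_one (map h s) 0 [::].
  have : row_mx y y1 = 0.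
    by apply: an_S; rewrite qval_dbl yc y11 mulr1 -mulr2n -mulr_natl pcharf0 // mul0r.
  rewrite -row_mx0 => /eq_row_mx[_ y10].
  by move: y11; rewrite y10 qval0 => /eqP; rewrite eq_sym oner_eq0.
have [|||t' [be' [st' t'0 E]]] := qperp_chain K2 _ _ _ cS; rewrite ?all_neq0_map ?zc //.
exists t', be'; split=> //.
  by move: st'; rewrite size_map tm => -[].
have extE : qext h (pfister t (qpfister s be)) = pfister (map h t) (qpfister (map h s) (h be)).
  by rewrite qext_pfister qext_qpfister.
apply: isometric_trans (qext_isometric h psiE') _; rewrite [qext h (pfister t _)]extE.
rewrite zc in E; apply: isometric_trans E _.
by apply: isometric_dbl; apply: pfisterC.
Qed.

(** The slots of [s] are treated one after the other: a factor [<<c, s>>] of [phi]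
    makes [<<s>>] a factor too, which becomes a factor of [psi] by induction, and
    [factor_extension_step] then adds [c]. *)
Lemma factor_extension (F : fieldType) (F2 : 2%N \in [pchar F]) r (ga a b : F) s m :
  a != 0 -> b != 0 -> nonzero r -> nonzero s ->
  (m + size s = (size r).+1)%N -> aniso_triple r ga a b ->
  factor_of (qpfister (a :: r) ga) s m ->
  exists (K : fieldType) (h : {rmorphism F -> K}),
    aniso_triple (map h r) (h ga) (h a) (h b) /\
    factor_of (qext h (qpfister (b :: r) ga)) (map h s) m.
Proof.
move=> a0 b0 r0; elim: s m => [|c s IHs] m.
  rewrite addn0 => _ -> gd _; exists F, idfun; rewrite map_id qext_id; split=> //.
  exists (b :: r), ga; split=> //; first by rewrite /= b0.
  exact: isometric_refl.
rewrite [nonzero _]/= addnS => /andP[c0 s0] [st] gd fa.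
have [||K [h [gdK fK]]] := IHs m.+1 s0 _ gd; first by rewrite addSn st.
  have [t [be [tm t0 E]]] := fa.
  exists (c :: t), be; split; rewrite /= ?tm ?c0 //.
  exact: isometric_trans E (isometric_sym (pfister_dblC _ _ _)).
have K2 := pchar_ext F2 h.
have faK := factor_ext h fa.
rewrite qext_qpfister /= in faK; rewrite qext_qpfister /= in fK.
have [||||||L [g [gdL fL]]] := factor_extension_step K2 _ _ _ _ _ _ gdK faK fK;
  rewrite ?fmorph_eq0 ?all_neq0_map ?size_map //.
exists L, (g \o h); split.
  by rewrite map_comp.
rewrite qext_comp qext_qpfister.
by move: fL; rewrite /= map_comp.
Qed.

(** * Factors as solutions of polynomial equations *)

Fixpoint dbl_dim k N := if k is k'.+1 then (dbl_dim k' N + dbl_dim k' N)%N else N.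

Section Eqn.
Variable R : comNzRingType.

(** The matrix of [<<s>>] times a form, with slots numbered from the innermost
    one.  Indexing by natural numbers makes the dimension depend on the number of
    slots only, so that the matrix can be mapped along ring morphisms. *)
Fixpoint pfister_mx (s : nat -> R) k N (A : 'M[R]_N) : 'M[R]_(dbl_dim k N) :=
  if k is k'.+1 then block_mx (pfister_mx s k' A) 0 0 (s k' *: pfister_mx s k' A) else A.

Definition binary_mx (be : R) : 'M[R]_(1 + 1) := block_mx 1%:M 1%:M 0 be%:M.

(** The equations of [isometric_altP] for [psi = <<s>><<t>>[1,be]], together with
    the invertibility of the slots [t], as one matrix.  The unknowns are gathered
    in one function [w], whose first argument selects in turn the slots [t],
    their inverses, the matrices [P], [Q], [U], and [be]: a family of solutions
    is then assembled entry by entry. *)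
Definition factor_eqn N (A : 'M[R]_N) k (s : nat -> R) m (w : nat -> nat -> nat -> R) :=
  let P : 'M_(N, dbl_dim k (dbl_dim m (1 + 1))) := \matrix_(i, j) w 2%N i j in
  let Q : 'M_(dbl_dim k (dbl_dim m (1 + 1)), N) := \matrix_(i, j) w 3%N i j in
  let U : 'M_N := \matrix_(i, j) w 4%N i j in
  block_mx (block_mx (P *m Q - 1%:M) 0 0 (Q *m P - 1%:M)) 0 0
    (block_mx (\row_(i < m) (w 0%N i 0%N * w 1%N i 0%N - 1)) 0 0
       (P *m pfister_mx s k (pfister_mx (fun i => w 0%N i 0%N) m
            (binary_mx (w 5%N 0%N 0%N))) *m P^T
         - (A + (U - U^T)))).
End Eqn.

Section EqnMap.
Variables (R R' : comNzRingType) (f : {rmorphism R -> R'}).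

Lemma pfister_mx_map s k N (A : 'M[R]_N) :
  map_mx f (pfister_mx s k A) = pfister_mx (fun i => f (s i)) k (map_mx f A).
Proof. by elim: k => //= k IHk; rewrite map_block_mx !map_mx0 map_mxZ IHk. Qed.

Lemma factor_eqn_map N (A : 'M[R]_N) k s m w :
  map_mx f (factor_eqn A k s m w) =
  factor_eqn (map_mx f A) k (fun i => f (s i)) m (fun a i j => f (w a i j)).
Proof.
rewrite /factor_eqn !map_block_mx !map_mx0 !map_mxB !map_mxD !map_mxM !map_mx1 map_mxN.
rewrite !pfister_mx_map map_block_mx !map_mx1 map_mx0 map_scalar_mx -!map_trmx.
do ![congr block_mx | congr (_ - _) | congr (_ + _) | congr (_ *m _) | congr trmx];
  by apply/matrixP => i j; rewrite !mxE ?rmorphB ?rmorphM ?rmorph1.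
Qed.
End EqnMap.

Section SatField.
Variable F : fieldType.

Lemma pfister_mxE (s : nat -> F) k n (A : 'M[F]_n) :
  QuadForm (pfister_mx s k A) = pfister (rev (mkseq s k)) (QuadForm A).
Proof. by elim: k => //= k IHk; rewrite mkseqS rev_rcons /= -IHk. Qed.

Lemma pfister_nth (s : seq F) (chi : quadForm F) :
  pfister s chi = QuadForm (pfister_mx (nth 0 (rev s)) (size s) (qmx chi)).
Proof. by rewrite pfister_mxE -(size_rev s) mkseq_nth revK; case: chi. Qed.

Lemma mx_nat m n (M : 'M[F]_(m, n)) : exists g, M = \matrix_(i, j) g (val i) (val j).
Proof.
exists (fun i j => if insub i is Some i' then
  if insub j is Some j' then M i' j' else 0 else 0).
by apply/matrixP => i j; rewrite mxE !valK.
Qed.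

Lemma factor_ofP (psi : quadForm F) s m k : size s = k ->
  factor_of psi s m <-> exists w, factor_eqn (qmx psi) k (nth 0 (rev s)) m w = 0.
Proof.
move=> <-; split=> [[t [be [tm t0]]]|[w]].
  rewrite pfister_nth /qpfister pfister_nth tm => /isometric_altP[P [Q [U [PQ QP E4]]]].
  have [gP EP] := mx_nat P; have [gQ EQ] := mx_nat Q; have [gU EU'] := mx_nat U.
  exists (fun a i j => match a with 0%N => nth 0 (rev t) i | 1%N => (nth 0 (rev t) i)^-1
    | 2%N => gP i j | 3%N => gQ i j | 4%N => gU i j | _ => be end).
  rewrite /factor_eqn -EP -EQ -EU' PQ QP [P *m _ *m _]E4 !subrr.
  suff -> : \row_(i < m) (nth 0 (rev t) i * (nth 0 (rev t) i)^-1 - 1) = 0.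
    by rewrite !block_mx0.
  apply/rowP => i; rewrite !mxE divff ?subrr //.
  move/(all_nthP 0): t0 => t0; rewrite nth_rev ?tm //.
  by apply: t0; rewrite tm; have := ltn_ord i; lia.
rewrite /factor_eqn; set P := \matrix_(i, j) w 2%N i j; set Q := \matrix_(i, j) w 3%N i j.
set U := \matrix_(i, j) w 4%N i j; rewrite -!block_mx0 => /eq_block_mx[E12 _ _ E34].
have [/eqP E1 _ _ /eqP E2] := eq_block_mx E12; have [E3 _ _ /eqP E4] := eq_block_mx E34.
move: E1 E2 E4; rewrite !subr_eq0 => /eqP PQ /eqP QP /eqP E4.
exists (rev (mkseq (fun i => w 0%N i 0%N) m)), (w 5%N 0%N 0%N); split.
- by rewrite size_rev size_mkseq.
- rewrite all_rev; apply/(all_nthP 0) => i; rewrite size_mkseq => im.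
  rewrite nth_mkseq //; move/rowP/(_ (Ordinal im)): E3; rewrite !mxE /= => /eqP.
  by rewrite subr_eq0; apply: contraTneq => ->; rewrite mul0r eq_sym oner_eq0.
rewrite /qpfister -(pfister_mxE _ _ (binary_mx _)) pfister_nth.
by apply/isometric_altP; exists P, Q, U.
Qed.
End SatField.

(** * Ultraproducts of fields and subfields *)

Section FieldProd.
Local Open Scope quotient_scope.
Variables (I : Type) (i0 : I) (K : I -> fieldType).

(** The index [i0] witnesses that the product is not the zero ring. *)
Definition pfield_prod of I : Type := forall i, K i.
Local Notation R := (pfield_prod i0).
HB.instance Definition _ := gen_eqMixin R.
HB.instance Definition _ := gen_choiceMixin R.

Definition prod_add (x y : R) : R := fun i => x i + y i.
Definition prod_mul (x y : R) : R := fun i => x i * y i.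
Definition prod_opp (x : R) : R := fun i => - x i.
Definition prod_zero : R := fun i => 0.
Definition prod_one : R := fun i => 1.
Fact prod_addA : associative prod_add.
Proof. by move=> x y z; apply: functional_extensionality_dep => i; apply: addrA. Qed.
Fact prod_addC : commutative prod_add.
Proof. by move=> x y; apply: functional_extensionality_dep => i; apply: addrC. Qed.
Fact prod_add0 : left_id prod_zero prod_add.
Proof. by move=> x; apply: functional_extensionality_dep => i; apply: add0r. Qed.
Fact prod_addN : left_inverse prod_zero prod_opp prod_add.
Proof. by move=> x; apply: functional_extensionality_dep => i; apply: addNr. Qed.
HB.instance Definition _ :=
  GRing.isZmodule.Build R prod_addA prod_addC prod_add0 prod_addN.
Fact prod_mulA : associative prod_mul.
Proof. by move=> x y z; apply: functional_extensionality_dep => i; apply: mulrA. Qed.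
Fact prod_mulC : commutative prod_mul.
Proof. by move=> x y; apply: functional_extensionality_dep => i; apply: mulrC. Qed.
Fact prod_mul1 : left_id prod_one prod_mul.
Proof. by move=> x; apply: functional_extensionality_dep => i; apply: mul1r. Qed.
Fact prod_mulD : left_distributive prod_mul prod_add.
Proof. by move=> x y z; apply: functional_extensionality_dep => i; apply: mulrDl. Qed.
Fact prod_1neq0 : prod_one != 0.
Proof. by apply/eqP => /(congr1 (@^~ i0)) /eqP; rewrite oner_eq0. Qed.
HB.instance Definition _ := GRing.Zmodule_isComNzRing.Build R
  prod_mulA prod_mulC prod_mul1 prod_mulD prod_1neq0.

Definition prod_ev (i : I) (x : R) : K i := x i.
Fact prod_ev_add i : zmod_morphism (@prod_ev i). Proof. by []. Qed.
Fact prod_ev_mul i : monoid_morphism (@prod_ev i). Proof. by []. Qed.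
HB.instance Definition _ i :=
  GRing.isZmodMorphism.Build R (K i) (@prod_ev i) (@prod_ev_add i).
HB.instance Definition _ i :=
  GRing.isMonoidMorphism.Build R (K i) (@prod_ev i) (@prod_ev_mul i).

Variables (U : set_system I) (UU : UltraFilter U).

Definition null (x : R) : bool := `[< U (fun i => x i = 0) >].
Fact null_ideal : idealr_closed null.
Proof.
split.
- by apply/asboolP; apply: filterS filterT.
- apply/asboolP => /filter_ex [i /= /eqP]. by rewrite oner_eq0.
move=> a x y /asboolP xU /asboolP yU; apply/asboolP.
apply: filterS2 xU yU => i /= x0 y0.
by rewrite [LHS](_ : _ = a i * x i + y i) // x0 y0 mulr0 addr0.
Qed.
HB.instance Definition _ := isIdealr.Build R null null_ideal.
Definition null_idealr : idealr R := null.
Definition uprod := {ideal_quot null_idealr}.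
HB.instance Definition _ := GRing.ComNzRing.on uprod.
Local Notation pr := (\pi_uprod : R -> uprod).

Fact pr_eq0 x : pr x = 0 <-> U (fun i => x i = 0).
Proof.
rewrite -(rmorph0 (\pi_uprod)); split.
  move/eqP; rewrite -Quotient.idealrBE subr0. by move/asboolP.
by move=> h; apply/eqP; rewrite -Quotient.idealrBE subr0; apply/asboolP.
Qed.
Definition uinv (z : uprod) : uprod := pr (fun i => (repr z i)^-1 : K i).
Fact umulV z : z != 0 -> uinv z * z = 1.
Proof.
rewrite /uinv -{1 3}(reprK z); set x := repr z => /eqP/pr_eq0 nx.
have /(_ (fun i => x i = 0)) [//|UC] := @in_ultra_setVsetC _ U _ UU.
rewrite -rmorphM -(rmorph1 (\pi_uprod)); apply/eqP.
rewrite -subr_eq0 -rmorphB; apply/eqP/pr_eq0.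
apply: filterS UC => i /= /eqP xi.
by rewrite [LHS](_ : _ = (x i)^-1 * x i - 1) // mulVf ?subrr.
Qed.
Fact uinv0 : uinv 0 = 0.
Proof.
apply/pr_eq0.
have /pr_eq0 : pr (repr (0 : uprod)) = 0 by rewrite reprK.
by apply: filterS => i /= ->; rewrite invr0.
Qed.
HB.instance Definition _ := GRing.ComNzRing_isField.Build uprod umulV uinv0.
End FieldProd.

Section Ultraproduct.
Local Open Scope quotient_scope.

Lemma ultraproduct (I : Type) (K : I -> fieldType) (U : set_system I) :
  UltraFilter U ->
  exists (L : fieldType) (R : comNzRingType) (ev : forall i, {rmorphism R -> K i})
         (p : {rmorphism R -> L}),
  [/\ forall y : (forall i, K i), exists x, forall i, ev i x = y i,
      forall z, exists x, p x = z &
      forall x, p x = 0 <-> U (fun i => ev i x = 0)].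
Proof.
move=> UU; have [i0 _] := filter_ex (filterT : U setT).
exists (uprod i0 K UU), (pfield_prod K i0), (@prod_ev I i0 K).
exists (\pi_(uprod i0 K UU)); split.
- by move=> y; exists y.
- by move=> z; exists (repr z); apply: reprK.
- exact: pr_eq0.
Qed.
End Ultraproduct.

Section Subfield.
Variables (L : fieldType) (P : L -> Prop).
Hypotheses (P1 : P 1) (PB : forall x y, P x -> P y -> P (x - y)).
Hypotheses (PM : forall x y, P x -> P y -> P (x * y)) (PV : forall x, P x -> P x^-1).
(** The argument [a] ties the predicate to the section hypotheses, from which its
    closure properties follow. *)
Definition sub_pred (a : P 1) (x : L) : bool := `[< P x >].
Local Notation S := (sub_pred P1 : pred L).
Fact sub_closed : divring_closed S.
Proof.
split; first by apply/asboolP.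
- by move=> x y /asboolP ? /asboolP ?; apply/asboolP/PB.
- by move=> x y /asboolP ? /asboolP ?; apply/asboolP/PM => //; apply: PV.
Qed.
HB.instance Definition _ := GRing.isDivringClosed.Build L (sub_pred P1) sub_closed.
Record subf := Subf {subf_val :> L ; _ : subf_val \in sub_pred P1}.
HB.instance Definition _ := [isSub for subf_val].
HB.instance Definition _ := [Choice of subf by <:].
HB.instance Definition _ := [SubChoice_isSubComUnitRing of subf by <:].
HB.instance Definition _ := [SubComUnitRing_isSubIntegralDomain of subf by <:].
HB.instance Definition _ := [SubIntegralDomain_isSubField of subf by <:].
Lemma subfield_exists :
  exists (M : fieldType) (j : {rmorphism M -> L}), forall z, P z <-> exists x, j x = z.
Proof.
exists subf, (val : {rmorphism subf -> L}) => z; split.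
  by move=> Pz; have h : z \in S by [apply/asboolP]; exists (Subf h).
by case=> -[x /= h] <-; apply/asboolP.
Qed.
End Subfield.

Lemma rmorphism_of (R S : pzRingType) (g : R -> S) :
  zmod_morphism g -> monoid_morphism g -> exists h : {rmorphism R -> S}, h =1 g.
Proof.
move=> gA gM.
pose gA' := GRing.isZmodMorphism.Build R S g gA.
pose gM' := GRing.isMonoidMorphism.Build R S g gM.
pose h : {rmorphism R -> S} := HB.pack g gA' gM'.
by exists h.
Qed.

Lemma nth_rev_map (R R' : comNzRingType) (f : {rmorphism R -> R'}) (s : seq R) :
  (fun i => f (nth 0 (rev s) i)) = nth 0 (rev (map f s)).
Proof.
apply/funext => i; rewrite -map_rev; have [lt_i|le_i] := ltnP i (size (rev s)).
  by rewrite (nth_map 0).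
by rewrite !nth_default ?size_map // rmorph0.
Qed.

Section Los.
Variables (I : Type) (K : I -> fieldType) (U : set_system I) (UU : UltraFilter U).
Variables (L : fieldType) (R : comNzRingType) (ev : forall i, {rmorphism R -> K i})
          (p : {rmorphism R -> L}).
Hypotheses (ev_surj : forall y : (forall i, K i), exists x, forall i, ev i x = y i)
           (p_surj : forall z, exists x, p x = z)
           (los : forall x, p x = 0 <-> U (fun i => ev i x = 0)).

Lemma los_eq x y : U (fun i => ev i x = ev i y) -> p x = p y.
Proof.
move=> h; apply/eqP; rewrite -subr_eq0 -rmorphB; apply/eqP/los.
by apply: filterS h => i xy; rewrite rmorphB xy subrr.
Qed.

Lemma los_mx m n (M : 'M[R]_(m, n)) :
  map_mx p M = 0 <-> U (fun i => map_mx (ev i) M = 0).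
Proof.
split=> [M0|h].
  have : U (fun i => forall t : 'I_m * 'I_n, ev i (M t.1 t.2) = 0).
    apply: filter_forall => t; apply/los.
    by move/matrixP/(_ t.1 t.2): M0; rewrite !mxE.
  by apply: filterS => i Mi; apply/matrixP => a b; rewrite !mxE (Mi (a, b)).
apply/matrixP => a b; rewrite !mxE; apply/los.
by apply: filterS h => i /matrixP/(_ a b); rewrite !mxE.
Qed.

Variables (F : fieldType) (h : forall i, {rmorphism F -> K i}) (hL : {rmorphism F -> L}).
Hypothesis hLE : forall x z, (forall i, ev i z = h i x) -> p z = hL x.

Lemma lift_mx m n (A : 'M[F]_(m, n)) : exists2 B : 'M[R]_(m, n),
  map_mx p B = map_mx hL A & forall i, map_mx (ev i) B = map_mx (h i) A.
Proof.
pose g (x : F) : R := projT1 (cid (ev_surj (fun i => h i x))).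
have gE x i : ev i (g x) = h i x by rewrite /g; case: cid => z /= ->.
exists (map_mx g A) => [|i]; apply/matrixP => a b; rewrite !mxE //.
by apply: hLE => i; apply: gE.
Qed.

Lemma ultra_aniso n (A : 'M[F]_n) :
  (forall i, aniso (map_mx (h i) A)) -> aniso (map_mx hL A).
Proof.
move=> an x; have [B <- evB] := lift_mx A.
pose X : 'rV[R]_n := \row_j projT1 (cid (p_surj (x 0 j))).
have Xx : map_mx p X = x by apply/rowP => j; rewrite !mxE; case: cid.
rewrite -Xx qval_map => /los x0; apply/los_mx; apply: filterS x0 => i.
by rewrite -qval_map evB => /an.
Qed.

(** The theorem of Los for the predicate [factor_of]: its solutions over [L] lift to
    [R], and solutions over the [K i] assemble to one over [R]. *)
Lemma los_factor (psi : quadForm F) (s : seq R) m :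
  factor_of (qext hL psi) (map p s) m <->
  U (fun i => factor_of (qext (h i) psi) (map (ev i) s) m).
Proof.
have [B pB evB] := lift_mx (qmx psi).
have evE i W : map_mx (ev i) (factor_eqn B (size s) (nth 0 (rev s)) m W) =
    factor_eqn (qmx (qext (h i) psi)) (size s) (nth 0 (rev (map (ev i) s))) m
      (fun a b c => ev i (W a b c)).
  by rewrite factor_eqn_map evB (nth_rev_map (ev i)).
have pE W : map_mx p (factor_eqn B (size s) (nth 0 (rev s)) m W) =
    factor_eqn (qmx (qext hL psi)) (size s) (nth 0 (rev (map p s))) m
      (fun a b c => p (W a b c)).
  by rewrite factor_eqn_map pB (nth_rev_map p).
split=> [/(factor_ofP _ _ (size_map _ s))[w w0]|fU].
  pose W a b c := projT1 (cid (p_surj (w a b c))).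
  have Ww a b c : p (W a b c) = w a b c by rewrite /W; case: cid.
  have : map_mx p (factor_eqn B (size s) (nth 0 (rev s)) m W) = 0.
    rewrite pE -[RHS]w0; congr factor_eqn.
    by do 3!apply/funext => ?; rewrite Ww.
  move/los_mx; apply: filterS => i; rewrite evE => E.
  by apply/(factor_ofP _ _ (size_map _ s)); exists (fun a b c => ev i (W a b c)).
have [w wP] : exists w : forall i, nat -> nat -> nat -> K i, forall i,
    factor_of (qext (h i) psi) (map (ev i) s) m ->
    factor_eqn (qmx (qext (h i) psi)) (size s) (nth 0 (rev (map (ev i) s))) m (w i) = 0.
  have ex i : exists w, factor_of (qext (h i) psi) (map (ev i) s) m ->
    factor_eqn (qmx (qext (h i) psi)) (size s) (nth 0 (rev (map (ev i) s))) m w = 0.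
    have [/(factor_ofP _ _ (size_map _ s))[w w0]|nf] :=
      pselect (factor_of (qext (h i) psi) (map (ev i) s) m).
      by exists w.
    by exists (fun _ _ _ => 0).
  exists (fun i => projT1 (cid (ex i))) => i; by case: cid.
pose W a b c := projT1 (cid (ev_surj (fun i => w i a b c))).
have Ww i : (fun a b c => ev i (W a b c)) = w i.
  by do 3!apply/funext => ?; rewrite /W; case: cid => z /= ->.
apply/(factor_ofP _ _ (size_map _ s)); exists (fun a b c => p (W a b c)).
rewrite -pE; apply/los_mx.
by apply: filterS fU => i /wP; rewrite evE Ww.
Qed.
End Los.

Lemma ultra_limit (F : fieldType) (I : Type) (K : I -> fieldType) (U : set_system I)
    (UU : UltraFilter U) (h : forall i, {rmorphism F -> K i}) :
  exists (L : fieldType) (R : comNzRingType) (ev : forall i, {rmorphism R -> K i})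
         (p : {rmorphism R -> L}) (hL : {rmorphism F -> L}),
  [/\ forall y : (forall i, K i), exists x, forall i, ev i x = y i,
      forall z, exists x, p x = z,
      forall x, p x = 0 <-> U (fun i => ev i x = 0) &
      forall x z, (forall i, ev i z = h i x) -> p z = hL x].
Proof.
have [L [R [ev [p [ev_surj p_surj los]]]]] := @ultraproduct I K U UU.
pose g (x : F) : R := projT1 (cid (ev_surj (fun i => h i x))).
have gE x i : ev i (g x) = h i x by rewrite /g; case: cid => z /= ->.
have pE x z : (forall i, ev i z = h i x) -> p z = p (g x).
  move=> zx; apply: (los_eq UU los); apply: filterS filterT => i _.
  by rewrite zx gE.
have [||hL hLE] := @rmorphism_of F L (p \o g).
- move=> x y /=; rewrite -rmorphB; apply/esym/pE => i.
  by rewrite !rmorphB !gE.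
- split=> [|x y] /=; first by rewrite -(rmorph1 p); apply/esym/pE => i; rewrite !rmorph1.
  by rewrite -rmorphM; apply/esym/pE => i; rewrite !rmorphM !gE.
exists L, R, ev, p, hL; split=> // x z /pE ->.
by rewrite hLE.
Qed.

(** * Treating all bilinear forms over one field *)

Record extension (F : fieldType) := Extension {
  ext_field : fieldType;
  ext_map : {rmorphism F -> ext_field}
}.

Section Closure.
Variables (F : fieldType) (r : seq F) (ga a b : F).
Hypotheses (F2 : 2%N \in [pchar F]) (a0 : a != 0) (b0 : b != 0) (r0 : nonzero r).

Definition linked_form (e : bool) := qpfister ((if e then a else b) :: r) ga.

Definition links (K : fieldType) (h : {rmorphism F -> K}) e (s : seq F) :=
  forall m, nonzero s -> (m + size s = (size r).+1)%N ->
    factor_of (linked_form e) s m -> factor_of (qext h (linked_form (~~ e))) (map h s) m.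

Definition aniso_triple_ext (K : fieldType) (h : {rmorphism F -> K}) :=
  aniso_triple (map h r) (h ga) (h a) (h b).

Lemma aniso_triple_ext_comp (K L : fieldType) (h : {rmorphism F -> K})
    (g : {rmorphism K -> L}) :
  aniso_triple (map g (map h r)) (g (h ga)) (g (h a)) (g (h b)) -> aniso_triple_ext (g \o h).
Proof. by move=> gd; rewrite /aniso_triple_ext [map _ r]map_comp. Qed.

Lemma qext_linked_form (K : fieldType) (h : {rmorphism F -> K}) e :
  qext h (linked_form e) = qpfister (h (if e then a else b) :: map h r) (h ga).
Proof. exact: qext_qpfister. Qed.

(** Problems solved over an extension stay solved over larger ones, so a list can
    be processed one element at a time. *)
Lemma finite_links (l : seq (bool * seq F)) : aniso_triple r ga a b ->
  exists X : extension F, aniso_triple_ext (ext_map X) /\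
    forall p, p \in l -> links (ext_map X) p.1 p.2.
Proof.
move=> gd; elim: l => [|[e s] l [[K h] /= [gdK lK]]].
  by exists (Extension idfun); split=> //; rewrite /aniso_triple_ext map_id.
suff [L [g [gdL lL]]] : exists (L : fieldType) (g : {rmorphism K -> L}),
    aniso_triple_ext (g \o h) /\ links (g \o h) e s.
  exists (Extension (g \o h)); split=> // p /=; rewrite inE => /predU1P[-> //|/lK lp].
  move=> m s0 sm /(lp m s0 sm)/(factor_ext g).
  by rewrite /= qext_comp [map (g \o h) _]map_comp.
have [[m [s0 sm fe]]|none] := pselect (exists m, [/\ nonzero s,
    (m + size s = (size r).+1)%N & factor_of (linked_form e) s m]); last first.
  exists K, idfun; split; first by apply: aniso_triple_ext_comp; rewrite map_id.
  by move=> m s0 sm fe; case: none; exists m.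
have sm' : (m + size (map h s) = (size (map h r)).+1)%N by rewrite !size_map.
have [L [g [gdL fL]]] : exists (L : fieldType) (g : {rmorphism K -> L}),
    aniso_triple_ext (g \o h) /\
    factor_of (qext (g \o h) (linked_form (~~ e))) (map (g \o h) s) m.
  have K2 := pchar_ext F2 h.
  have {}fe := factor_ext h fe; rewrite qext_linked_form in fe.
  case: e fe => fe.
    have [||||L [g [gdL fL]]] := factor_extension K2 _ _ _ _ sm' gdK fe;
      rewrite ?fmorph_eq0 ?all_neq0_map //.
    exists L, g; split; first exact: aniso_triple_ext_comp.
    by rewrite qext_comp qext_linked_form [map (g \o h) _]map_comp.
  have [||||L [g [gdL fL]]] := factor_extension K2 _ _ _ _ sm' (aniso_triple_sym gdK) fe;
    rewrite ?fmorph_eq0 ?all_neq0_map //.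
  exists L, g; split; first exact/aniso_triple_ext_comp/aniso_triple_sym.
  by rewrite qext_comp qext_linked_form [map (g \o h) _]map_comp.
exists L, g; split=> // m' _ sm'' _; suff -> : m' = m by [].
by apply/eqP; rewrite -(eqn_add2r (size s)) sm sm''.
Qed.

Lemma aniso_triple_extE (K : fieldType) (h : {rmorphism F -> K}) : aniso_triple_ext h <->
  [/\ aniso (qmx (qext h (linked_form true))), aniso (qmx (qext h (linked_form false))) &
      aniso (qmx (qext h (qpfister (a * b :: r) ga)))].
Proof.
by rewrite /linked_form !qext_qpfister /= rmorphM.
Qed.

(** Indices of the ultraproduct are finite lists of problems, and the ultrafilter
    contains, for each problem, the set of lists in which it occurs. *)
Lemma all_links : aniso_triple r ga a b ->
  exists X : extension F, aniso_triple_ext (ext_map X) /\ forall e s, links (ext_map X) e s.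
Proof.
move=> gd; pose I := seq (bool * seq F).
have [X XP] : exists X : I -> extension F, forall l, aniso_triple_ext (ext_map (X l)) /\
    forall p, p \in l -> links (ext_map (X l)) p.1 p.2.
  by exists (fun l => projT1 (cid (finite_links l gd))) => l; case: cid.
pose cone (l : I) : set I := fun l' => {subset l <= l'}.
have coneF : ProperFilter (filter_from setT cone).
  apply: filter_from_proper; last by move=> l _; exists l.
  apply: filter_fromT_filter; first by exists [::].
  move=> l1 l2; exists (l1 ++ l2) => l h; split=> p pl; apply: h;
  by rewrite mem_cat pl ?orbT.
have [U [UU coneU]] := ultraFilterLemma coneF.
pose h l := ext_map (X l).
have [L [R [ev [p [hL [ev_surj p_surj los hLE]]]]]] := ultra_limit UU h.
have aniso_L n (A : 'M[F]_n) : (forall l, aniso (map_mx (h l) A)) -> aniso (map_mx hL A).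
  exact: (ultra_aniso UU ev_surj p_surj los hLE).
exists (Extension hL); split.
  by apply/aniso_triple_extE; split; apply: aniso_L => l; have [/aniso_triple_extE[]] := XP l.
move=> e s m s0 sm fe.
have [t tE] : exists t : seq R, map p t = map hL s /\ forall l, map (ev l) t = map (h l) s.
  pose g (x : F) : R := projT1 (cid (ev_surj (fun i => h i x))).
  have gE x i : ev i (g x) = h i x by rewrite /g; case: cid => z /= ->.
  exists (map g s); split=> [|l]; rewrite -map_comp; apply: eq_map => x /=.
    exact: hLE.
  exact: gE.
have [<- tl] := tE; apply/(los_factor UU ev_surj p_surj los hLE).
apply: filterS (_ : U (cone [:: (e, s)])); last by apply: coneU; exists [:: (e, s)].
move=> l sub_l; rewrite tl; have [_ /(_ (e, s)) lk] := XP l.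
by apply: lk => //; apply: sub_l; rewrite mem_head.
Qed.
End Closure.

(** * Limits of towers *)

Section Chain.
Variables (K : nat -> fieldType) (c : forall n, {rmorphism K n -> K n.+1}).

(** Transporting [v] along an equality of stages avoids composing the maps of the
    tower into one from [K n0] to each later field. *)
Lemma chain_from n0 (v : K n0) : exists y : forall n, K n,
  y n0 = v /\ forall n, (n0 <= n)%N -> y n.+1 = c n (y n).
Proof.
pose y := fix y n : K n := match n0 =P n with
  | ReflectT e => eq_rect n0 (fun n => K n : Type) v n e
  | ReflectF _ => match n return K n with 0%N => 0 | n'.+1 => c n' (y n') end
  end.
exists y; split=> [|n le_n].
  have yE n : y n = match n0 =P n with
    | ReflectT e => eq_rect n0 (fun n => K n : Type) v n e
    | ReflectF _ => match n return K n with 0%N => 0 | n'.+1 => c n' (y n') end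
    end by case: n.
  by rewrite yE; case: eqP => // e; rewrite (eq_irrelevance e erefl).
by rewrite [LHS]/=; case: eqP => // e; move: le_n; rewrite {1}e ltnn.
Qed.

Variables (U : set_system nat) (UU : UltraFilter U).
Hypothesis U_oo : forall n0, U (fun n => (n0 <= n)%N).
Variables (L : fieldType) (R : comNzRingType) (ev : forall n, {rmorphism R -> K n})
          (p : {rmorphism R -> L}).
Hypotheses (ev_surj : forall y : (forall i, K i), exists x, forall i, ev i x = y i)
           (los : forall x, p x = 0 <-> U (fun i => ev i x = 0)).

Definition coherent n0 (x : R) := forall n, (n0 <= n)%N -> ev n.+1 x = c n (ev n x).

Lemma coherentW n0 n1 x : (n0 <= n1)%N -> coherent n0 x -> coherent n1 x.
Proof. by move=> le h n ln; apply: h; apply: leq_trans ln. Qed.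

Lemma coherent_lift n0 (v : K n0) : exists2 x, coherent n0 x & ev n0 x = v.
Proof.
have [y [<- yc]] := chain_from v; have [x xE] := ev_surj y.
by exists x; [move=> n; rewrite !xE; apply: yc | rewrite xE].
Qed.

(** The direct limit of the tower, as the set of elements of an ultraproduct [L]
    that are represented by an eventually coherent sequence.  The ultraproduct
    itself is too large: a factor over [L] comes with scalars that need not be
    defined at any single stage. *)
Definition in_limit (z : L) := exists n0 x, coherent n0 x /\ p x = z.

Lemma limit_field : exists (M : fieldType) (j : {rmorphism M -> L}),
  forall z, in_limit z <-> exists x, j x = z.
Proof.
apply: (@subfield_exists L in_limit).
- by exists 0%N, 1; split; [move=> n _|]; rewrite !rmorph1.
- move=> x y [n [u [cu <-]]] [m [v [cv <-]]].
  exists (maxn n m), (u - v); split; last by rewrite rmorphB.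
  move=> k; rewrite geq_max => /andP[nk mk].
  by rewrite !rmorphB cu // cv.
- move=> x y [n [u [cu <-]]] [m [v [cv <-]]].
  exists (maxn n m), (u * v); split; last by rewrite rmorphM.
  move=> k; rewrite geq_max => /andP[nk mk].
  by rewrite !rmorphM cu // cv.
move=> x [n [u [cu <-]]]; have [v vE] := ev_surj (fun i => (ev i u)^-1).
exists n, v; split.
  by move=> k nk; rewrite !vE cu // fmorphV.
have [pu0|pu0] := eqVneq (p u) 0.
  rewrite pu0 invr0; apply/los; move/los: pu0.
  by apply: filterS => i ui; rewrite vE ui invr0.
apply: (mulfI pu0); rewrite divff // -rmorphM -(rmorph1 p); apply: (los_eq UU los).
have [U0|] := @in_ultra_setVsetC _ U (fun i => ev i u = 0) UU.
  by move/los: U0 => u0; rewrite u0 eqxx in pu0.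
apply: filterS => i /= /eqP ui.
by rewrite rmorphM vE rmorph1 divff.
Qed.

Variables (F : fieldType) (h : forall i, {rmorphism F -> K i}) (hL : {rmorphism F -> L}).
Hypothesis hc : forall n x, c n (h n x) = h n.+1 x.
Hypothesis hLE : forall x z, (forall i, ev i z = h i x) -> p z = hL x.
Hypothesis p_surj : forall z, exists x, p x = z.

Variables (M : fieldType) (j : {rmorphism M -> L}).
Hypothesis jE : forall z, in_limit z <-> exists x, j x = z.

Lemma limit_map : exists hM : {rmorphism F -> M}, forall x, j (hM x) = hL x.
Proof.
have ex x : exists z, j z = hL x.
  apply/jE; have [z zE] := ev_surj (fun i => h i x).
  exists 0%N, z; split; last exact: hLE.
  by move=> n _; rewrite !zE hc.
pose g x := projT1 (cid (ex x)).
have gE x : j (g x) = hL x by rewrite /g; case: cid.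
have [||hM hME] := @rmorphism_of F M g.
- by move=> x y; apply: (fmorph_inj j); rewrite rmorphB !gE rmorphB.
- split=> [|x y]; apply: (fmorph_inj j); first by rewrite gE !rmorph1.
  by rewrite rmorphM !gE rmorphM.
by exists hM => x; rewrite hME gE.
Qed.

Variable hM : {rmorphism F -> M}.
Hypothesis hME : forall x, j (hM x) = hL x.

Lemma limit_lift (s : seq M) : exists n0 (t : seq R),
  map p t = map j s /\ forall x, x \in t -> coherent n0 x.
Proof.
elim: s => [|x s [n0 [t [ts ct]]]]; first by exists 0%N, [::].
have [n1 [y [cy yx]]] : in_limit (j x) by apply/jE; exists x.
exists (maxn n0 n1), (y :: t); split; first by rewrite /= ts yx.
move=> z; rewrite inE => /predU1P[->|/ct cz].
  exact: coherentW (leq_maxr _ _) cy.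
exact: coherentW (leq_maxl _ _) cz.
Qed.

Lemma map_limit m n (A : 'M[F]_(m, n)) : map_mx j (map_mx hM A) = map_mx hL A.
Proof. by apply/matrixP => a b; rewrite !mxE hME. Qed.

Lemma limit_aniso n (A : 'M[F]_n) : (forall i, aniso (map_mx (h i) A)) ->
  aniso (map_mx hM A).
Proof.
move=> an x x0; apply/rowP => k; apply: (fmorph_inj j).
have := ultra_aniso UU ev_surj p_surj los hLE an (x := map_mx j x).
rewrite -map_limit qval_map x0 rmorph0 => /(_ erefl)/rowP/(_ k).
by rewrite !mxE rmorph0.
Qed.

(** The slots [s] lift to sequences that are coherent from some stage on.  Since
    [U] contains no bounded set, [<<s>>] is a factor of [psi] at such a stage [n],
    hence of [psi'] at stage [n + 1].  A solution of the equations there extends to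
    a coherent sequence, which solves them at every later stage and thus in the
    limit. *)
Lemma limit_factor (psi psi' : quadForm F) (s : seq M) m :
  (forall n (t : seq (K n)), size t = size s -> nonzero t ->
     factor_of (qext (h n) psi) t m -> factor_of (qext (h n.+1) psi') (map (c n) t) m) ->
  nonzero s -> factor_of (qext hM psi) s m -> factor_of (qext hM psi') s m.
Proof.
move=> step s0 /(factor_ext j).
have jext chi : qext j (qext hM chi) = qext hL chi by rewrite /qext /= map_limit.
have [n0 [t [ts ct]]] := limit_lift s.
rewrite jext -ts => /(los_factor UU ev_surj p_surj los hLE) fU.
have t_neq0 : U (fun n => nonzero (map (ev n) t)).
  have : nonzero (map p t) by rewrite ts all_neq0_map.
  move: t {ct fU ts} => t; elim: t => [_|x t IHt /= /andP[px /IHt]].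
    by apply: filterS filterT.
  have [U0|] := @in_ultra_setVsetC _ U (fun i => ev i x = 0) UU.
    by move/los: U0 => x0; rewrite x0 eqxx in px.
  by apply: filterS2 => i /= /eqP -> ->.
have [n [n0n [fn tn0]]] := filter_ex (filterI (U_oo n0) (filterI fU t_neq0)).
have st : size (map (ev n) t) = size s.
  by rewrite size_map -(size_map p) ts size_map.
have := step n _ st tn0 fn.
have -> : map (c n) (map (ev n) t) = map (ev n.+1) t.
  by rewrite -map_comp; apply/eq_in_map => x xt /=; rewrite (ct x xt).
have st' : size (map (ev n.+1) t) = size s by rewrite -st !size_map.
move/(factor_ofP _ _ st') => [w w0].
have ex a b e : exists x, coherent n.+1 x /\ ev n.+1 x = w a b e.
  by have [x] := coherent_lift (w a b e); exists x.
pose W a b e := projT1 (cid (ex a b e)).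
have cW a b e : coherent n.+1 (W a b e) by rewrite /W; case: cid => x [].
have Ww a b e : ev n.+1 (W a b e) = w a b e by rewrite /W; case: cid => x [].
have [B pB evB] := lift_mx ev_surj hLE (qmx psi').
pose eqR := factor_eqn B (size s) (nth 0 (rev t)) m W.
have evE i : map_mx (ev i) eqR = factor_eqn (qmx (qext (h i) psi')) (size s)
    (nth 0 (rev (map (ev i) t))) m (fun a b e => ev i (W a b e)).
  by rewrite factor_eqn_map evB (nth_rev_map (ev i)).
have ev0 k : (n.+1 <= k)%N -> map_mx (ev k) eqR = 0.
  have WE : (fun a b e => ev n.+1 (W a b e)) = w.
    by do 3!apply/funext => ?; apply: Ww.
  elim: k => // k IHk; rewrite leq_eqVlt => /predU1P[<-|lt_nk].
    by rewrite evE WE.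
  have -> : map_mx (ev k.+1) eqR = map_mx (c k) (map_mx (ev k) eqR).
    have E1 : map_mx (c k) (qmx (qext (h k) psi')) = qmx (qext (h k.+1) psi').
      by apply/matrixP => a b; rewrite !mxE hc.
    have E2 : map (c k) (map (ev k) t) = map (ev k.+1) t.
      rewrite -map_comp; apply/eq_in_map => x xt /=; rewrite (ct x xt) //.
      by rewrite (leq_trans n0n) // (leq_trans (leqnSn n)).
    have E3 : (fun a b e => c k (ev k (W a b e))) = (fun a b e => ev k.+1 (W a b e)).
      by do 3!apply/funext => ?; rewrite cW.
    by rewrite !evE factor_eqn_map E1 (nth_rev_map (c k)) E2 E3.
  by rewrite IHk // map_mx0.
have p0 : map_mx p eqR = 0.
  by apply/(los_mx UU los); apply: filterS (U_oo n.+1) => k; apply: ev0.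
have exM a b e : exists x, j x = p (W a b e).
  by apply/jE; exists n.+1, (W a b e).
apply/(factor_ofP _ _ (erefl (size s))).
exists (fun a b e => projT1 (cid (exM a b e))).
have jE0 : map_mx j (factor_eqn (qmx (qext hM psi')) (size s) (nth 0 (rev s)) m
    (fun a b e => projT1 (cid (exM a b e)))) = 0.
  have E3 : (fun a b e => j (projT1 (cid (exM a b e)))) = (fun a b e => p (W a b e)).
    by do 3!apply/funext => ?; case: cid.
  rewrite factor_eqn_map (nth_rev_map j) map_limit E3 -ts.
  by move: p0; rewrite /eqR factor_eqn_map (nth_rev_map p) pB.
apply/matrixP => a b; apply: (fmorph_inj j).
by move/matrixP/(_ a b): jE0; rewrite [RHS]mxE [LHS]mxE [in X in _ -> _ = X]mxE rmorph0.
Qed.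
End Chain.

(** * The theorem *)

Record stage (F : fieldType) r (ga a b : F) := Stage {
  st_field : fieldType;
  st_map : {rmorphism F -> st_field};
  st_aniso : aniso_triple_ext r ga a b st_map
}.

Section Final.
Variables (F : fieldType) (r : seq F) (ga a b : F).
Hypotheses (F2 : 2%N \in [pchar F]) (a0 : a != 0) (b0 : b != 0) (r0 : nonzero r).
Hypothesis gd : aniso_triple r ga a b.
Local Notation stage := (stage r ga a b).
Local Notation lf := (linked_form r ga a b).

Lemma stage_step (X : stage) : exists (Y : stage) (c : {rmorphism st_field X -> st_field Y}),
  (forall x, c (st_map X x) = st_map Y x) /\
  forall e s m, nonzero s -> (m + size s = (size r).+1)%N ->
    factor_of (qext (st_map X) (lf e)) s m ->
    factor_of (qext (st_map Y) (lf (~~ e))) (map c s) m.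
Proof.
case: X => K h gdK /=; have K2 := pchar_ext F2 h.
have [|||[L c] [/= gdL lL]] := all_links (a := h a) (b := h b) (r := map h r) K2 _ _ _ gdK;
  rewrite ?fmorph_eq0 ?all_neq0_map //.
have gdL' : aniso_triple_ext r ga a b (c \o h) by apply: aniso_triple_ext_comp.
exists (Stage gdL'), c; split=> //= e s m s0 sm fe.
have lE e' : linked_form (map h r) (h ga) (h a) (h b) e' = qext h (lf e').
  by rewrite qext_linked_form /linked_form; case: e'.
rewrite qext_comp -lE; apply: lL => //; first by rewrite size_map.
by rewrite lE.
Qed.

(** The index [e] exchanges the roles of [phi] and [psi], so the conclusion says
    that both have the same factors. *)
Lemma closed_extension : exists (M : fieldType) (h : {rmorphism F -> M}),
  aniso_triple_ext r ga a b h /\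
  forall e s m, nonzero s -> (m + size s = (size r).+1)%N ->
    factor_of (qext h (lf e)) s m -> factor_of (qext h (lf (~~ e))) s m.
Proof.
have gd0 : aniso_triple_ext r ga a b idfun by rewrite /aniso_triple_ext map_id.
pose nxt X := projT1 (cid (stage_step X)).
have nxtP X : exists c : {rmorphism st_field X -> st_field (nxt X)},
    (forall x, c (st_map X x) = st_map (nxt X) x) /\
    forall e s m, nonzero s -> (m + size s = (size r).+1)%N ->
      factor_of (qext (st_map X) (lf e)) s m ->
      factor_of (qext (st_map (nxt X)) (lf (~~ e))) (map c s) m.
  by rewrite /nxt; case: cid.
pose st n := iter n nxt (Stage gd0).
pose K n := st_field (st n); pose h n : {rmorphism F -> K n} := st_map (st n).
pose c n : {rmorphism K n -> K n.+1} := projT1 (cid (nxtP (st n))).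
have hc n x : c n (h n x) = h n.+1 x by rewrite /c; case: cid => c' [].
have step n e s m : nonzero s -> (m + size s = (size r).+1)%N ->
    factor_of (qext (h n) (lf e)) s m -> factor_of (qext (h n.+1) (lf (~~ e))) (map (c n) s) m.
  by rewrite /c; case: cid => c' [] /= _; apply.
have [U [UU ooU]] := ultraFilterLemma eventually_filter.
have U_oo n0 : U (fun n => (n0 <= n)%N) by apply: ooU; exists n0.
have [L [R [ev [p [hL [ev_surj p_surj los hLE]]]]]] := ultra_limit UU h.
have [M [j jE]] := limit_field c UU ev_surj los.
have [hM hME] := limit_map ev_surj hc hLE jE.
have an n (A : 'M[F]_n) : (forall i, aniso (map_mx (h i) A)) -> aniso (map_mx hM A).
  exact: (limit_aniso UU ev_surj los hLE p_surj hME).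
exists M, hM; split.
  apply/aniso_triple_extE.
  by split; apply: an => i; have /aniso_triple_extE[] := st_aniso (st i).
move=> e s m s0 sm.
apply: (limit_factor UU U_oo ev_surj los hc hLE p_surj jE hME _ s0) => n t ts tn0.
by apply: step => //; rewrite ts.
Qed.
End Final.

(** [tr] is used with [m + 1 = n - k]; for [k = n] a bilinear factor would have a
    0-fold quadratic cofactor, and there is none. *)
Lemma bil_factor_transfer (K : fieldType) n k N (B : symBilForm K) phi psi :
  (n = N.+1)%N ->
  (forall s m, nonzero s -> (m + size s = N)%N -> factor_of phi s m -> factor_of psi s m) ->
  bil_factor n k B phi -> bil_factor n k B psi.
Proof.
move=> nN tr [[s [sk s0 Bs]] [rho [[t [be [tn t0 rhoE]]] phiE]]].
split; first by exists s.
have tsN : (size t + size s = N)%N by move: tn; rewrite sk nN; lia.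
have [|t' [be' [st' t'0 psiE]]] := tr s (size t) s0 tsN.
  exists t, be; split=> //; apply: isometric_trans phiE _.
  apply: isometric_trans (isometric_tensl _ Bs) _.
  apply: isometric_trans (qtens_bpfister _ _) _; apply: isometric_pfister.
  exact: isometric_trans rhoE (qtens_bpfister _ _).
exists (qtens (bpfister t') (binary 1 1 be')); split.
  by exists t', be'; split; rewrite ?st' //; apply: isometric_refl.
apply: isometric_trans psiE _; apply: isometric_sym.
apply: isometric_trans (isometric_tensl _ Bs) _.
apply: isometric_trans (qtens_bpfister _ _) _; apply: isometric_pfister.
exact: qtens_bpfister.
Qed.

Lemma one_fold_factor (F : fieldType) n (rho phi : quadForm F) : (2 <= n)%N ->
  quad_factor n (n - 1) rho phi ->
  exists2 a, a != 0 & isometric phi (qdbl a rho).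
Proof.
move=> n2 [_ [B [[s [ss s0 Bs]] phiE]]].
have : size s = 1%N by rewrite ss; lia.
case: s s0 Bs {ss} => [|a [|]] //= /andP[a0 _] Bs _; exists a => //.
apply: isometric_trans phiE _; apply: isometric_trans (isometric_tensl _ Bs) _.
exact: (qtens_bpfister [:: a]).
Qed.

Theorem theorem4p6 (F : fieldType) (n m : nat) (phi psi : quadForm F)
    (charF2 : 2%N \in [pchar F])
    (n_ge2 : (2 <= n)%N)
    (m_range : (1 <= m <= n - 1)%N)
    (phi_pfister : quad_pfister n phi)
    (psi_pfister : quad_pfister n psi)
    (phi_psi_distinct : ~ isometric phi psi)
    (phi_nonhyp : ~ hyperbolic phi)
    (psi_nonhyp : ~ hyperbolic psi)
    (sep_linked : separably_linked n (n - 1) phi psi)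
    (insep_linked : totally_insep_linked n m phi psi) :
  exists (K : fieldType) (f : {rmorphism F -> K}),
    [/\ totally_insep_linked n (m + 1) (qext f phi) (qext f psi),
        ~ isometric (qext f phi) (qext f psi),
        ~ hyperbolic (qext f phi) &
        ~ hyperbolic (qext f psi)].
Proof.
have [rho [fphi fpsi]] := sep_linked.
have [[r [ga [rn r0 rhoE]]] _] := fphi.
have {}rhoE := isometric_trans rhoE (qtens_bpfister _ _).
have [a a0 phiE] := one_fold_factor n_ge2 fphi.
have [b b0 psiE] := one_fold_factor n_ge2 fpsi.
have {phiE}phiE : isometric phi (qpfister (a :: r) ga).
  exact: isometric_trans phiE (isometric_dbl _ rhoE).
have {psiE}psiE : isometric psi (qpfister (b :: r) ga).
  exact: isometric_trans psiE (isometric_dbl _ rhoE).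
have an_a : aniso (qmx (qpfister (a :: r) ga)).
  apply: contrapT => /(pfister_isotropic_hyperbolic charF2) h; apply: phi_nonhyp.
  by apply: hyperbolic_iso phiE _; apply: h; rewrite /= a0.
have an_b : aniso (qmx (qpfister (b :: r) ga)).
  apply: contrapT => /(pfister_isotropic_hyperbolic charF2) h; apply: psi_nonhyp.
  by apply: hyperbolic_iso psiE _; apply: h; rewrite /= b0.
have an_rho : aniso (qmx (qpfister r ga)).
  move=> x x0; have : row_mx x (0 : 'rV_(qdim (qpfister r ga))) = 0.
    by apply: an_a; rewrite qval_dbl x0 qval0 mulr0 addr0.
  by rewrite -row_mx0 => /eq_row_mx[].
have gd : aniso_triple r ga a b.
  split=> //; apply: contrapT => not_an; apply: phi_psi_distinct.
  apply: isometric_trans phiE _; apply: isometric_sym; apply: isometric_trans psiE _.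
  have sim_ab : simfactor (qpfister r ga) (a * b).
    apply: (isotropic_dbl_simfactor charF2 _ an_rho _ not_an); first by rewrite mulf_neq0.
    by move=> x; apply: pfister_round.
  apply: isometric_trans (qdbl_simfactor b sim_ab) _; rewrite mulrCA -expr2.
  exact/isometric_sym/qdbl_simfactor/simfactor_sqr.
have [K [h [gdK closed]]] := closed_extension charF2 a0 b0 r0 gd.
have K2 := pchar_ext charF2 h.
have [an_aK an_bK an_abK] := gdK.
have phiK := qext_isometric h phiE; rewrite qext_qpfister in phiK.
have psiK := qext_isometric h psiE; rewrite qext_qpfister in psiK.
have hr0 : nonzero (map h r) by rewrite all_neq0_map.
have ha0 : h a != 0 by rewrite fmorph_eq0.
have hb0 : h b != 0 by rewrite fmorph_eq0.
exists K, h; split.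
- move=> B _; have nr : n = (size r).+2 by move: rn; lia.
  have closed' e s k : nonzero s -> (k + size s = (size r).+1)%N ->
      factor_of (qext h (if e then phi else psi)) s k ->
      factor_of (qext h (if ~~ e then phi else psi)) s k.
    move=> s0 sk [t [be [tk t0 E]]].
    have fE e' : isometric (qext h (if e' then phi else psi))
        (qext h (linked_form r ga a b e')).
      by apply: qext_isometric; case: e'.
    have [|t' [be' [tk' t'0 E']]] := closed e s k s0 sk.
      by exists t, be; split=> //; apply: isometric_trans (isometric_sym (fE e)) E.
    by exists t', be'; split=> //; apply: isometric_trans (fE (~~ e)) E'.
  split; apply: bil_factor_transfer nr _ => s k.
    exact: (closed' true).
  exact: (closed' false).
- move=> iso.
  have sub : subform (qpfister (h a :: map h r) (h ga)) (qpfister (h b :: map h r) (h ga)).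
    apply: subform_iso; apply: isometric_trans (isometric_sym phiK) _.
    exact: isometric_trans iso psiK.
  apply: (shared_subform_isotropic K2 _ _ ha0 (oner_neq0 K) _ _ sub (S := 1%:M)) an_abK.
  + by apply: nondeg_pfister => //; apply: nondeg_binary.
  + rewrite [X in (X < _)%N]qdim_qpfister [X in (_ < X)%N](qdim_qpfister (h a :: map h r)).
    by rewrite ltn_exp2l.
  + by move=> x; apply: (@pfister_round _ (h a :: map h r)); rewrite /= ha0.
  + exact: (qpfister_one (h a :: map h r) (h ga)).
  by move=> y; rewrite mulmx1 mul1r.
- apply: aniso_not_hyperbolic; last by rewrite (isometric_dim phiK) qdim_qpfister expn_gt0.
  exact: isometric_aniso phiK _.
apply: aniso_not_hyperbolic; last by rewrite (isometric_dim psiK) qdim_qpfister expn_gt0.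
exact: isometric_aniso psiK _.
Qed.
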